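(* The polygon $\mathcal{F}$ equals the Dirichlet domain of $\Gamma$ centered at $0$, i.e. $\mathcal{F}=D(0)$.
   Context: Hyperbolic disk: $\mathbb{D}=\{z\in\mathbb{C}:|z|<1\}$ with metric $ds^2=4(dx^2+dy^2)/(1-x^2-y^2)^2$ and associated distance $d_{\mathbb{D}}$; its orientation-preserving isometry group is $\mathrm{PSU}(1,1)=\{\pm\begin{pmatrix}p&\bar q\\ q&\bar p\end{pmatrix}: p,q\in\mathbb{C},\ |p|^2-|q|^2=1\}$. The group $\Delta$: $\Delta=\langle s_1,s_2,s_3\mid s_1^2=s_2^2=s_3^2=(s_1s_2)^7=(s_2s_3)^3=(s_1s_3)^2=1\rangle$. It acts faithfully on $\mathbb{D}$ as follows. Let $P_0=0$, $P_1=r_0(\cos\frac{5\pi}{14},\sin\frac{5\pi}{14})$, $P_2=(0,y_0)$, where $r_0$ is the unique root in $(0,1)$ of $1-6x^2-97x^4-244x^6-97x^8-6x^{10}+x^{12}$ and $y_0$ is the unique root in $(0,1)$ of $1-6x^2-48x^4-83x^6-48x^8-6x^{10}+x^{12}$ (the hyperbolic triangle $P_0P_1P_2$ has angles $\pi/7,\pi/2,\pi/3$ at $P_0,P_1,P_2$). The generators $s_1,s_2,s_3$ act as the hyperbolic reflections in the geodesics through $P_0P_1$, $P_0P_2$, $P_1P_2$ respectively (products act as compositions, rightmost factor first). The elements $\gamma_i$: define $\gamma_1=s_2s_3s_2s_1s_2s_1s_3s_2s_1s_2s_1s_3s_2s_1s_2s_1s_2s_3s_2s_1s_2s_1s_2s_1s_3s_2s_1s_2s_1s_3s_2s_1s_2s_1s_3s_2s_1s_2$,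 $\gamma_2=s_1s_2s_3s_2s_1s_2s_1s_2s_1s_3s_2s_1s_2s_1s_3s_2s_1s_2s_1s_2s_3s_2s_1s_2s_1s_2s_1s_3s_2s_1s_2s_1s_3s_2s_1s_2$, $\gamma_3=(s_1s_2)^3(s_3s_2s_1s_2s_1)^3s_2s_3s_2s_1s_2s_1s_2s_1s_3s_2s_1s_2s_1s_2s_3s_2s_1s_2s_1s_3s_2s_1s_2$, $\gamma_4=(s_1s_2)^2s_3s_2s_1s_2s_1s_2s_3s_2s_1s_2s_1s_2s_1s_3s_2s_1s_2s_1s_3s_2s_1s_2s_1s_2s_3s_2s_1s_2s_1s_2s_3s_2(s_1s_2)^2$, $\gamma_5=s_1s_3s_2s_1s_2s_1s_3s_2s_1s_2s_1s_2s_3s_2s_1s_2s_1s_2s_1s_3s_2s_1s_2s_1s_3s_2s_1s_2s_1s_2s_3s_2s_1s_2s_1s_2$, $\gamma_6=s_2s_3s_2s_1s_2s_1s_2s_3s_2s_1s_2s_1s_2s_1s_3s_2s_1s_2s_1s_3s_2s_1s_2s_1s_2s_3s_2s_1s_2s_1s_2s_1s_3s_2s_1s_2s_1s_2$, and $\gamma_i=s_2s_1\gamma_{i-6}s_1s_2$ for $7\le i\le 42$. $\Gamma$ is the subgroup of $\Delta$ generated by $\gamma_1,\dots,\gamma_{42}$; via the action of $\Delta$ on $\mathbb{D}$ in which $s_1,s_2,s_3$ act as the hyperbolic reflections in the geodesics through $P_0P_1$, $P_0P_2$, $P_1P_2$ respectively, it is regarded as a subgroup of $\mathrm{PSU}(1,1)$.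 The polygon $\mathcal{F}$: for $g=\pm\begin{pmatrix}a&b\\c&d\end{pmatrix}\in\mathrm{PSU}(1,1)$ with $c\ne0$, the isometric circle is $I(g)=\{z\in\mathbb{C}:|cz+d|=1\}$ and its exterior is $\mathrm{ext}(I(g))=\{z\in\mathbb{D}:|cz+d|>1\}$. Then $\mathcal{F}$ is the closure of $\bigcap_{i=1}^{42}\mathrm{ext}(I(\gamma_i))$. It is a compact hyperbolic polygon in $\mathbb{D}$ with $42$ sides. For $w\in\mathbb{D}$ with trivial stabilizer in $\Gamma$, the Dirichlet domain centered at $w$ is $D(w)=\{z\in\mathbb{D}: d_{\mathbb{D}}(z,w)\le d_{\mathbb{D}}(z,gw)\text{ for all }g\in\Gamma\}$. *)

(* Defs.v *)
From Stdlib Require Export Reals List.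
From Coquelicot Require Export Coquelicot.
Export ListNotations.

Open Scope R_scope.

(** * The hyperbolic disk *)

Definition disk (z : C) : Prop := Cmod z < 1.

Definition C1_path (f : R -> C) (z w : C) : Prop :=
  f 0 = z /\ f 1 = w /\
  forall t, 0 <= t <= 1 ->
    disk (f t) /\
    ex_derive (fun s => Re (f s)) t /\ continuous (Derive (fun s => Re (f s))) t /\
    ex_derive (fun s => Im (f s)) t /\ continuous (Derive (fun s => Im (f s))) t.

(* Length for the metric 4 (dx^2 + dy^2) / (1 - x^2 - y^2)^2. *)
Definition path_length (f : R -> C) : R :=
  RInt (fun t =>
    2 * sqrt (Derive (fun s => Re (f s)) t ^ 2 + Derive (fun s => Im (f s)) t ^ 2)
      / (1 - Re (f t) ^ 2 - Im (f t) ^ 2)) 0 1.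

(* [real] is harmless: for z, w in the disk the set of lengths is nonempty
   and bounded below by 0. *)
Definition hyp_dist (z w : C) : R :=
  real (Glb_Rbar (fun L => exists f, C1_path f z w /\ L = path_length f)).

(* Orientation-preserving isometry of the disk carrying a to 0; its inverse is
   [to_origin (- a)]. *)
Definition to_origin (a z : C) : C := ((z - a) / (1 - Cconj a * z))%C.

(* Hyperbolic reflection in the geodesic through P and Q (P <> Q): after moving
   P to 0 the geodesic is the diameter through u, and the reflection is the
   Euclidean one, w |-> (u / conj u) * conj w. *)
Definition reflection (P Q z : C) : C :=
  let u := to_origin P Q in
  to_origin (- P) (u / Cconj u * Cconj (to_origin P z))%C.

(** * The triangle group Delta *)

Inductive gen := s1 | s2 | s3.

Definition word := list gen.

Fixpoint word_pow (w : word) (n : nat) : word :=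
  match n with O => [] | S n' => w ++ word_pow w n' end.

Definition relators : list word :=
  [ word_pow [s1] 2; word_pow [s2] 2; word_pow [s3] 2;
    word_pow [s1; s2] 7; word_pow [s2; s3] 3; word_pow [s1; s3] 2 ].

(* Delta is the quotient of [word] by [delta_eq]. The generators are
   involutions, so words without inverse letters suffice, and the inverse of
   the class of w is the class of [rev w]. *)
Inductive delta_eq : word -> word -> Prop :=
| delta_relator r : In r relators -> delta_eq r []
| delta_app u u' v v' : delta_eq u u' -> delta_eq v v' -> delta_eq (u ++ v) (u' ++ v')
| delta_refl u : delta_eq u u
| delta_sym u v : delta_eq u v -> delta_eq v u
| delta_trans u v w : delta_eq u v -> delta_eq v w -> delta_eq u w.

(** * The action of Delta on the disk *)

Definition is_r0 (x : R) : Prop :=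
  0 < x < 1 /\
  1 - 6 * x ^ 2 - 97 * x ^ 4 - 244 * x ^ 6 - 97 * x ^ 8 - 6 * x ^ 10 + x ^ 12 = 0.

Definition is_y0 (x : R) : Prop :=
  0 < x < 1 /\
  1 - 6 * x ^ 2 - 48 * x ^ 4 - 83 * x ^ 6 - 48 * x ^ 8 - 6 * x ^ 10 + x ^ 12 = 0.

Definition P0 : C := RtoC 0.
Definition P1 (r0 : R) : C := (r0 * cos (5 * PI / 14), r0 * sin (5 * PI / 14)).
Definition P2 (y0 : R) : C := (0, y0).

Definition gen_act (r0 y0 : R) (s : gen) : C -> C :=
  match s with
  | s1 => reflection P0 (P1 r0)
  | s2 => reflection P0 (P2 y0)
  | s3 => reflection (P1 r0) (P2 y0)
  end.

Fixpoint act (r0 y0 : R) (g : word) (z : C) : C :=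
  match g with
  | [] => z
  | s :: g' => gen_act r0 y0 s (act r0 y0 g' z)
  end.

(** * The group Gamma *)

(* Meaningful for 1 <= i <= 42; in the last case i = j + 6 with j >= 1. *)
Fixpoint gamma (i : nat) : word :=
  match i with
  | 0 => []
  | 1 =>
      [s2; s3; s2; s1; s2; s1; s3; s2; s1; s2; s1; s3; s2; s1; s2; s1; s2;
      s3; s2; s1; s2; s1; s2; s1; s3; s2; s1; s2; s1; s3; s2; s1; s2; s1;
      s3; s2; s1; s2]
  | 2 =>
      [s1; s2; s3; s2; s1; s2; s1; s2; s1; s3; s2; s1; s2; s1; s3; s2; s1;
      s2; s1; s2; s3; s2; s1; s2; s1; s2; s1; s3; s2; s1; s2; s1; s3; s2;
      s1; s2]
  | 3 =>
      word_pow [s1; s2] 3 ++ word_pow [s3; s2; s1; s2; s1] 3 ++ [s2; s3; s2;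
      s1; s2; s1; s2; s1; s3; s2; s1; s2; s1; s2; s3; s2; s1; s2; s1; s3;
      s2; s1; s2]
  | 4 =>
      word_pow [s1; s2] 2 ++ [s3; s2; s1; s2; s1; s2; s3; s2; s1; s2; s1;
      s2; s1; s3; s2; s1; s2; s1; s3; s2; s1; s2; s1; s2; s3; s2; s1; s2;
      s1; s2; s3; s2] ++ word_pow [s1; s2] 2
  | 5 =>
      [s1; s3; s2; s1; s2; s1; s3; s2; s1; s2; s1; s2; s3; s2; s1; s2; s1;
      s2; s1; s3; s2; s1; s2; s1; s3; s2; s1; s2; s1; s2; s3; s2; s1; s2;
      s1; s2]
  | 6 =>
      [s2; s3; s2; s1; s2; s1; s2; s3; s2; s1; s2; s1; s2; s1; s3; s2; s1;
      s2; s1; s3; s2; s1; s2; s1; s2; s3; s2; s1; s2; s1; s2; s1; s3; s2;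
      s1; s2; s1; s2]
  | S (S (S (S (S (S j))))) => [s2; s1] ++ gamma j ++ [s1; s2]
  end%nat.

(* The subgroup of Delta generated by the [gamma i], as a [delta_eq]-saturated
   set of words. *)
Inductive Gamma : word -> Prop :=
| Gamma_gen i : (1 <= i <= 42)%nat -> Gamma (gamma i)
| Gamma_one : Gamma []
| Gamma_mul u v : Gamma u -> Gamma v -> Gamma (u ++ v)
| Gamma_inv u : Gamma u -> Gamma (rev u)
| Gamma_eq u v : delta_eq u v -> Gamma u -> Gamma v.

(** * The polygon F *)

(* (p, q) stands for the element +-(p, conj q; q, conj p) of PSU(1,1). *)
Definition in_SU11 (p q : C) : Prop := Cmod p ^ 2 - Cmod q ^ 2 = 1.

Definition mobius (p q z : C) : C := ((p * z + Cconj q) / (q * z + Cconj p))%C.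

Definition represents (r0 y0 : R) (p q : C) (g : word) : Prop :=
  in_SU11 p q /\ forall z, disk z -> act r0 y0 g z = mobius p q z.

Definition ext_isometric_circle (p q z : C) : Prop :=
  disk z /\ 1 < Cmod (q * z + Cconj p)%C.

(* ext (I (g)), g being viewed in PSU(1,1). The matrix representing g is unique
   up to sign and the sign does not matter, so the existential quantifier only
   names it; the set is empty if g has no isometric circle. *)
Definition ext_I (r0 y0 : R) (g : word) (z : C) : Prop :=
  exists p q : C,
    represents r0 y0 p q g /\ q <> RtoC 0 /\ ext_isometric_circle p q z.

Definition closure_C (A : C -> Prop) (z : C) : Prop :=
  forall eps : R, 0 < eps -> exists w, A w /\ Cmod (w - z)%C < eps.

Definition polygon_F (r0 y0 : R) : C -> Prop :=
  closure_C (fun z => forall i, (1 <= i <= 42)%nat -> ext_I r0 y0 (gamma i) z).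

(** * Dirichlet domains of Gamma *)

(* The stabilizer is taken in Gamma viewed as a subgroup of PSU(1,1). *)
Definition trivial_stabilizer (r0 y0 : R) (w : C) : Prop :=
  forall g, Gamma g -> act r0 y0 g w = w ->
    forall z, disk z -> act r0 y0 g z = z.

Definition dirichlet_domain (r0 y0 : R) (w z : C) : Prop :=
  disk z /\
  forall g, Gamma g -> hyp_dist z w <= hyp_dist z (act r0 y0 g w).

(* Main.v *)
(* The polygon and the Dirichlet inequalities are linear in the Minkowski model,
   where Delta acts by reflections defined over Z[mu], mu = 2 cos (pi / 7). By
   convexity it suffices to show that the open ball around each vertex of the
   polygon which passes through 0 contains no point of the orbit of 0 under Gamma.
   Gamma lies in the kernel of a homomorphism from Delta onto PSL(2,8) x Z/2, so it
   is enough to list the points of the orbit of 0 under Delta in such a ball and to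
   look at their images in this finite group. The list is complete because, after
   moving the vertex to the fundamental chamber, the distance to it never decreases
   along a reduced word: this is the theorem that a reduced word sends simple roots
   to roots of constant sign. *)

Require Import Defs.
From Stdlib Require Import Psatz ZArith Bool Classical Wf_nat.

(** * The ring [Z[mu]], mu = 2 cos (pi / 7) *)

(** The isometric circle of g is the perpendicular bisector of 0 and g^-1 0, so D(0) lies in F
    without effort; the other inclusion must draw infinitely many inequalities from 42. Membership
    in Gamma is replaced by a decidable necessary condition, that g fixes [base_colour]. Little is
    lost: in PSL(2,8) x Z/2 an ordered pair of distinct points has a stabilizer of order 1008 / 72 =
    14, which is the image of the dihedral group generated by s1 and s2, the stabilizer of 0. So the
    colour of an orbit point determines its orbit under the kernel. The same dihedral group permutes
    the sides, which leaves a sector of angle pi / 7 to examine. Two difficulties come from the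
    definitions. F is a closure taken in C and has to be kept off the unit circle; this holds
    because the cones are spanned by timelike vectors with positive mutual products. The distance is
    an infimum over paths, bounded below by Busemann functions. *)

Definition mu : R := 2 * cos (PI / 7).

(** From cos (4 pi / 7) = - cos (3 pi / 7): a quartic in cos (pi / 7) with the spurious root -1, and
    the remaining cubic is the minimal polynomial. *)
Lemma mu_eq : mu ^ 3 = mu ^ 2 + 2 * mu - 1.
Proof.
assert (H4 : cos (4 * (PI / 7)) = - cos (3 * (PI / 7))).
{ replace (4 * (PI / 7)) with (PI - 3 * (PI / 7)) by field.
  now rewrite Rtrigo_facts.cos_pi_minus. }
assert (H2 : cos (2 * (PI / 7)) = 2 * cos (PI / 7) ^ 2 - 1).
{ rewrite cos_2a_cos; ring. }
assert (E4 : cos (4 * (PI / 7)) = 2 * cos (2 * (PI / 7)) ^ 2 - 1).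
{ replace (4 * (PI / 7)) with (2 * (2 * (PI / 7))) by ring.
  rewrite cos_2a_cos; ring. }
assert (E3 : cos (3 * (PI / 7)) = 4 * cos (PI / 7) ^ 3 - 3 * cos (PI / 7)).
{ replace (3 * (PI / 7)) with (2 * (PI / 7) + PI / 7) by ring.
  rewrite cos_plus, H2, sin_2a.
  pose proof (sin2_cos2 (PI / 7)) as P; unfold Rsqr in P.
  replace (2 * sin (PI / 7) * cos (PI / 7) * sin (PI / 7))
    with (2 * cos (PI / 7) * (1 - cos (PI / 7) * cos (PI / 7))) by (rewrite <- P; ring).
  ring. }
assert (Hc : 0 < cos (PI / 7)).
{ apply cos_gt_0; pose proof PI_RGT_0; lra. }
rewrite H2 in E4; rewrite E4, E3 in H4; unfold mu.
assert ((cos (PI / 7) + 1)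
  * (8 * cos (PI / 7) ^ 3 - 4 * cos (PI / 7) ^ 2 - 4 * cos (PI / 7) + 1) = 0) by nra.
apply Rmult_integral in H as [H | H]; nra.
Qed.

(** The cubic has three real roots. The crude bound 1.7, from pi / 7 < pi / 6, singles out the
    largest, because the difference quotients of the cubic are positive beyond it. *)
Lemma mu_bounds : 1801937 / 1000000 < mu < 1801938 / 1000000.
Proof.
pose proof mu_eq as E.
assert (B : sqrt 3 / 2 < cos (PI / 7)).
{ rewrite <- cos_PI6; apply cos_decreasing_1; pose proof PI_RGT_0; lra. }
assert (S : 1.7 < sqrt 3).
{ rewrite <- (sqrt_square 1.7) by lra; apply sqrt_lt_1; lra. }
assert (M : 1.7 < mu) by (unfold mu; lra).
split; apply Rnot_le_lt; intro H.
- assert (0 <= (1801937 / 1000000 - mu)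
    * ((1801937 / 1000000) ^ 2 + 1801937 / 1000000 * mu + mu ^ 2
       - 1801937 / 1000000 - mu - 2)) by (apply Rmult_le_pos; nra).
  nra.
- assert (0 <= (mu - 1801938 / 1000000)
    * ((1801938 / 1000000) ^ 2 + 1801938 / 1000000 * mu + mu ^ 2
       - 1801938 / 1000000 - mu - 2)) by (apply Rmult_le_pos; nra).
  nra.
Qed.

Definition Zmu : Type := (Z * Z * Z)%type.

Definition zval (a : Zmu) : R :=
  let '(x, y, z) := a in IZR x + IZR y * mu + IZR z * mu ^ 2.

Definition zadd (a b : Zmu) : Zmu :=
  let '(x, y, z) := a in let '(x', y', z') := b in (x + x', y + y', z + z')%Z.
Definition zopp (a : Zmu) : Zmu := let '(x, y, z) := a in (- x, - y, - z)%Z.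
Definition zmul_mu (a : Zmu) : Zmu :=
  let '(x, y, z) := a in (- z, x + 2 * z, y + z)%Z.
Definition zscale (n : Z) (a : Zmu) : Zmu :=
  let '(x, y, z) := a in (n * x, n * y, n * z)%Z.
Definition zmul (a b : Zmu) : Zmu :=
  let '(x, y, z) := a in
  zadd (zscale x b) (zmul_mu (zadd (zscale y b) (zmul_mu (zscale z b)))).
Definition zsub (a b : Zmu) : Zmu := zadd a (zopp b).

Lemma zval_add a b : zval (zadd a b) = zval a + zval b.
Proof.
destruct a as [[x y] z], b as [[x' y'] z']; simpl; rewrite !plus_IZR; ring.
Qed.

Lemma zval_opp a : zval (zopp a) = - zval a.
Proof. destruct a as [[x y] z]; simpl; rewrite !opp_IZR; ring. Qed.

Lemma zval_sub a b : zval (zsub a b) = zval a - zval b.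
Proof. unfold zsub; rewrite zval_add, zval_opp; ring. Qed.

Lemma zval_mul_mu a : zval (zmul_mu a) = mu * zval a.
Proof.
destruct a as [[x y] z]; unfold zmul_mu, zval.
rewrite opp_IZR, !plus_IZR, mult_IZR.
replace (mu * (IZR x + IZR y * mu + IZR z * mu ^ 2))
  with (IZR x * mu + IZR y * mu ^ 2 + IZR z * mu ^ 3) by ring.
rewrite mu_eq; ring.
Qed.

Lemma zval_scale n a : zval (zscale n a) = IZR n * zval a.
Proof. destruct a as [[x y] z]; simpl; rewrite !mult_IZR; ring. Qed.

Lemma zval_mul a b : zval (zmul a b) = zval a * zval b.
Proof.
destruct a as [[x y] z]; unfold zmul.
rewrite !zval_add, zval_mul_mu, zval_add, zval_mul_mu, !zval_scale.
change (zval (x, y, z)) with (IZR x + IZR y * mu + IZR z * mu ^ 2); ring.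
Qed.

(* A lower bound of [10 ^ 12 * zval a], from [mu_bounds]. *)
Definition zlow (a : Zmu) : Z :=
  let '(x, y, z) := a in
  (x * 1000000000000
   + y * (if 0 <=? y then 1801937 else 1801938) * 1000000
   + z * (if 0 <=? z then 1801937 * 1801937 else 1801938 * 1801938))%Z.

(** Only [true] is informative, the bound being one-sided. An exact zero has zero coefficients and
    passes [znneg]; this settles the orbit points lying on the boundary of a ball. *)
Definition zpos (a : Zmu) : bool := (0 <? zlow a)%Z.
Definition znneg (a : Zmu) : bool := (0 <=? zlow a)%Z.
Definition zeqb (a b : Zmu) : bool :=
  let '(x, y, z) := a in let '(x', y', z') := b in
  ((x =? x') && (y =? y') && (z =? z'))%Z.

Lemma zlow_le a : IZR (zlow a) <= 1000000000000 * zval a.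
Proof.
destruct a as [[x y] z]; unfold zlow, zval.
pose proof mu_bounds as B.
assert (B2 : (1801937 / 1000000) ^ 2 < mu ^ 2 < (1801938 / 1000000) ^ 2) by nra.
rewrite !plus_IZR, !mult_IZR.
assert (Hy : IZR y * IZR (if (0 <=? y)%Z then 1801937 else 1801938) * 1000000
   <= 1000000000000 * (IZR y * mu)).
{ destruct (Z.leb_spec 0 y) as [H | H].
  - apply IZR_le in H; nra.
  - apply IZR_lt in H; nra. }
assert (Hz : IZR z * IZR (if (0 <=? z)%Z then 1801937 * 1801937
     else 1801938 * 1801938) <= 1000000000000 * (IZR z * mu ^ 2)).
{ destruct (Z.leb_spec 0 z) as [H | H]; rewrite mult_IZR.
  - apply IZR_le in H; nra.
  - apply IZR_lt in H; nra. }
lra.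
Qed.

Lemma zpos_spec a : zpos a = true -> 0 < zval a.
Proof.
intro H; apply Z.ltb_lt, IZR_lt in H; pose proof (zlow_le a); lra.
Qed.

Lemma znneg_spec a : znneg a = true -> 0 <= zval a.
Proof.
intro H; apply Z.leb_le, IZR_le in H; pose proof (zlow_le a); lra.
Qed.

Lemma zeqb_spec a b : zeqb a b = true -> a = b.
Proof.
destruct a as [[x y] z], b as [[x' y'] z']; unfold zeqb.
rewrite !andb_true_iff, !Z.eqb_eq; intros [[-> ->] ->]; reflexivity.
Qed.

(** * Words *)

Lemma delta_app_l u v v' : delta_eq v v' -> delta_eq (u ++ v) (u ++ v').
Proof. intro H; apply delta_app; [apply delta_refl | exact H]. Qed.

Lemma delta_app_r u u' v : delta_eq u u' -> delta_eq (u ++ v) (u' ++ v).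
Proof. intro H; apply delta_app; [exact H | apply delta_refl]. Qed.

Lemma delta_cons s v v' : delta_eq v v' -> delta_eq (s :: v) (s :: v').
Proof. exact (delta_app_l [s] v v'). Qed.

Lemma delta_square s : delta_eq [s; s] [].
Proof. apply delta_relator; destruct s; simpl; tauto. Qed.

Lemma delta_cancel s v : delta_eq (s :: s :: v) v.
Proof. exact (delta_app_r _ _ v (delta_square s)). Qed.

Lemma delta_rev_l u : delta_eq (rev u ++ u) [].
Proof.
induction u as [| s u IH]; simpl; [apply delta_refl |].
rewrite <- app_assoc; simpl.
eapply delta_trans; [apply delta_app_l, delta_cancel | exact IH].
Qed.

Lemma delta_rev_r u : delta_eq (u ++ rev u) [].
Proof. pose proof (delta_rev_l (rev u)) as H; now rewrite rev_involutive in H. Qed.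

Lemma delta_solve_l u x : delta_eq (u ++ x) [] -> delta_eq u (rev x).
Proof.
intro H.
apply delta_trans with ((u ++ x) ++ rev x).
- rewrite <- app_assoc; apply delta_sym.
  eapply delta_trans; [apply delta_app_l, delta_rev_r |].
  rewrite app_nil_r; apply delta_refl.
- apply (delta_app_r _ [] _ H).
Qed.

Lemma delta_rev_nil u : delta_eq u [] -> delta_eq (rev u) [].
Proof.
intro H; apply delta_trans with (rev u ++ u); [| apply delta_rev_l].
apply delta_sym; pose proof (delta_app_l (rev u) _ _ H) as E.
now rewrite app_nil_r in E.
Qed.

Lemma delta_even u v : delta_eq u v -> Nat.even (length u) = Nat.even (length v).
Proof.
induction 1 as [r H | u u' v v' _ IH1 _ IH2 | | |]; try congruence.
- simpl in H; decompose [or] H; subst; try reflexivity; contradiction.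
- now rewrite !length_app, !Nat.even_add, IH1, IH2.
Qed.

Definition reduced (w : word) : Prop :=
  forall w', delta_eq w w' -> (length w <= length w')%nat.

Lemma exists_reduced w : exists w', delta_eq w w' /\ reduced w'.
Proof.
remember (length w) as n eqn:E.
revert w E; induction n as [n IH] using lt_wf_ind; intros w ->.
destruct (classic (reduced w)) as [H | H]; [exists w; split; [apply delta_refl | easy] |].
apply not_all_ex_not in H as [v H]; apply imply_to_and in H as [H1 H2].
destruct (IH (length v) ltac:(lia) v eq_refl) as [w' [H3 H4]].
exists w'; split; [eapply delta_trans; eassumption | easy].
Qed.

Lemma reduced_app u v : reduced (u ++ v) -> reduced u /\ reduced v.
Proof.
intro H; split; intros w Hw.
- pose proof (H _ (delta_app_r _ _ v Hw)) as L; rewrite !length_app in L; lia.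
- pose proof (H _ (delta_app_l u _ _ Hw)) as L; rewrite !length_app in L; lia.
Qed.

Lemma reduced_cons s w : reduced (s :: w) -> reduced w.
Proof. intro H; now apply (reduced_app [s] w). Qed.

Lemma reduced_delta w w' :
  reduced w -> delta_eq w w' -> length w' = length w -> reduced w'.
Proof.
intros H E L v Hv; rewrite L; apply H; eapply delta_trans; eassumption.
Qed.

(** A generator changes the length in Delta by exactly one, since parity excludes equality; if the
    length drops, the class has a shortest word beginning with that generator. *)
Lemma not_reduced_cons s v :
  reduced v -> ~ reduced (s :: v) ->
  exists v', delta_eq v (s :: v') /\ length v = S (length v').
Proof.
intros H N; apply not_all_ex_not in N as [v' N].
apply imply_to_and in N as [E L]; simpl in L.
assert (Ev : delta_eq v (s :: v')).
{ eapply delta_trans; [apply delta_sym, (delta_cancel s) | apply delta_cons, E]. }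
exists v'; split; [exact Ev |].
pose proof (H _ Ev) as L2; simpl in L2.
assert (length v <> length v'); [| lia].
intro Q; pose proof (delta_even _ _ Ev) as P; simpl length in P.
rewrite <- Q, Nat.even_succ, <- Nat.negb_even in P.
destruct (Nat.even (length v)); discriminate.
Qed.

(** * The reflection representation *)

(* A point is given by its products [c1, c2, c3] with the unit normals of the
   three walls, a root by its coordinates in the basis of these normals. Twice
   the Gram matrix of the normals is ((2, -mu, 0), (-mu, 2, -1), (0, -1, 2)). *)
Definition vec : Type := (R * R * R)%type.
Definition zvec : Type := (Zmu * Zmu * Zmu)%type.

Definition crd (s : gen) {A : Type} (c : A * A * A) : A :=
  let '(c1, c2, c3) := c in match s with s1 => c1 | s2 => c2 | s3 => c3 end.

Definition vval (c : zvec) : vec :=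
  let '(c1, c2, c3) := c in (zval c1, zval c2, zval c3).

Definition refl (s : gen) (c : vec) : vec :=
  let '(c1, c2, c3) := c in
  match s with
  | s1 => (- c1, c2 + mu * c1, c3)
  | s2 => (c1 + mu * c2, - c2, c3 + c2)
  | s3 => (c1, c2 + c3, - c3)
  end.

Definition root_refl (s : gen) (a : vec) : vec :=
  let '(a1, a2, a3) := a in
  match s with
  | s1 => (mu * a2 - a1, a2, a3)
  | s2 => (a1, mu * a1 + a3 - a2, a3)
  | s3 => (a1, a2, a2 - a3)
  end.

Definition zrefl (s : gen) (c : zvec) : zvec :=
  let '(c1, c2, c3) := c in
  match s with
  | s1 => (zopp c1, zadd c2 (zmul_mu c1), c3)
  | s2 => (zadd c1 (zmul_mu c2), zopp c2, zadd c3 c2)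
  | s3 => (c1, zadd c2 c3, zopp c3)
  end.

Definition zroot_refl (s : gen) (a : zvec) : zvec :=
  let '(a1, a2, a3) := a in
  match s with
  | s1 => (zsub (zmul_mu a2) a1, a2, a3)
  | s2 => (a1, zsub (zadd (zmul_mu a1) a3) a2, a3)
  | s3 => (a1, a2, zsub a2 a3)
  end.

Definition wact (w : word) (c : vec) : vec := fold_right refl c w.
Definition zwact (w : word) (c : zvec) : zvec := fold_right zrefl c w.

(* The inverse of [w] acting on roots. *)
Definition root_act (w : word) (a : vec) : vec := fold_left (fun b s => root_refl s b) w a.
Definition zroot_act (w : word) (a : zvec) : zvec := fold_left (fun b s => zroot_refl s b) w a.

Definition zzero : Zmu := (0, 0, 0)%Z.
Definition zone : Zmu := (1, 0, 0)%Z.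
Definition zsimple (s : gen) : zvec :=
  match s with
  | s1 => (zone, zzero, zzero)
  | s2 => (zzero, zone, zzero)
  | s3 => (zzero, zzero, zone)
  end.
Definition simple (s : gen) : vec :=
  match s with s1 => (1, 0, 0) | s2 => (0, 1, 0) | s3 => (0, 0, 1) end.

Lemma zval_zero : zval zzero = 0.
Proof. simpl; ring. Qed.

Lemma zval_one : zval zone = 1.
Proof. simpl; ring. Qed.

Lemma vval_simple s : vval (zsimple s) = simple s.
Proof.
destruct s; unfold zsimple, vval; now rewrite ?zval_zero, ?zval_one.
Qed.

Lemma crd_vval s c : crd s (vval c) = zval (crd s c).
Proof. destruct s, c as [[c1 c2] c3]; reflexivity. Qed.

Lemma vval_refl s c : vval (zrefl s c) = refl s (vval c).
Proof.
destruct s, c as [[c1 c2] c3]; unfold zrefl, vval, refl;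
  now rewrite ?zval_opp, ?zval_add, ?zval_mul_mu.
Qed.

Lemma vval_root_refl s a : vval (zroot_refl s a) = root_refl s (vval a).
Proof.
destruct s, a as [[a1 a2] a3]; unfold zroot_refl, vval, root_refl;
  now rewrite ?zval_sub, ?zval_add, ?zval_mul_mu.
Qed.

Lemma vval_wact w c : vval (zwact w c) = wact w (vval c).
Proof.
induction w as [| s w IH]; simpl; [reflexivity | now rewrite vval_refl, IH].
Qed.

Lemma vval_root_act w a : vval (zroot_act w a) = root_act w (vval a).
Proof.
unfold zroot_act, root_act; revert a.
induction w as [| s w IH]; intro a; simpl; [reflexivity | now rewrite IH, vval_root_refl].
Qed.

Definition dot (c a : vec) : R :=
  let '(c1, c2, c3) := c in let '(a1, a2, a3) := a in c1 * a1 + c2 * a2 + c3 * a3.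

Definition comb (a x y z : vec) : vec :=
  let '(a1, a2, a3) := a in let '(x1, x2, x3) := x in
  let '(y1, y2, y3) := y in let '(z1, z2, z3) := z in
  (a1 * x1 + a2 * y1 + a3 * z1, a1 * x2 + a2 * y2 + a3 * z2,
   a1 * x3 + a2 * y3 + a3 * z3).

Ltac vec_eq := repeat match goal with |- (_, _) = (_, _) => apply f_equal2 end; try ring.

Lemma dot_refl s c a : dot (refl s c) a = dot c (root_refl s a).
Proof. destruct s, c as [[c1 c2] c3], a as [[a1 a2] a3]; simpl; ring. Qed.

Lemma dot_wact w c a : dot (wact w c) a = dot c (root_act w a).
Proof.
revert a; induction w as [| s w IH]; intro a; simpl; [reflexivity |].
now rewrite dot_refl, IH.
Qed.

Lemma dot_simple s c : dot c (simple s) = crd s c.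
Proof. destruct s, c as [[c1 c2] c3]; simpl; ring. Qed.

Lemma wact_app u v c : wact (u ++ v) c = wact u (wact v c).
Proof. apply fold_right_app. Qed.

Lemma root_act_app u v a : root_act (u ++ v) a = root_act v (root_act u a).
Proof. apply fold_left_app. Qed.

Lemma root_refl_comb s a x y z :
  root_refl s (comb a x y z) = comb a (root_refl s x) (root_refl s y) (root_refl s z).
Proof.
destruct s, a as [[a1 a2] a3], x as [[x1 x2] x3], y as [[y1 y2] y3], z as [[z1 z2] z3];
  simpl; vec_eq.
Qed.

Lemma root_act_comb w a x y z :
  root_act w (comb a x y z) = comb a (root_act w x) (root_act w y) (root_act w z).
Proof.
revert x y z; induction w as [| s w IH]; intros x y z; simpl; [reflexivity |].
now rewrite root_refl_comb, IH.
Qed.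

Lemma comb_simple a : comb a (simple s1) (simple s2) (simple s3) = a.
Proof. destruct a as [[a1 a2] a3]; simpl; vec_eq. Qed.

Lemma root_act_basis w a :
  root_act w a =
  comb a (root_act w (simple s1)) (root_act w (simple s2)) (root_act w (simple s3)).
Proof. now rewrite <- root_act_comb, comb_simple. Qed.

(** By linearity it is enough to compute, exactly in Z[mu], on the three simple roots. *)
Lemma root_act_relator r : In r relators -> forall a, root_act r a = a.
Proof.
intros H a; rewrite root_act_basis, <- !vval_simple, <- !vval_root_act.
assert (E : zroot_act r (zsimple s1) = zsimple s1 /\
  zroot_act r (zsimple s2) = zsimple s2 /\ zroot_act r (zsimple s3) = zsimple s3).
{ simpl in H; decompose [or] H; subst; try contradiction; repeat split; reflexivity. }
destruct E as (-> & -> & ->); rewrite !vval_simple; apply comb_simple.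
Qed.

Lemma root_act_delta u v : delta_eq u v -> forall a, root_act u a = root_act v a.
Proof.
induction 1 as [r H | u u' v v' _ IH1 _ IH2 | | |]; intro a; try congruence.
- now apply root_act_relator.
- now rewrite !root_act_app, IH1, IH2.
Qed.

Lemma wact_delta u v : delta_eq u v -> forall c, wact u c = wact v c.
Proof.
intros H c.
assert (E : forall s, crd s (wact u c) = crd s (wact v c)).
{ intro s; now rewrite <- !dot_simple, !dot_wact, (root_act_delta u v H). }
pose proof (E s1); pose proof (E s2); pose proof (E s3).
destruct (wact u c) as [[? ?] ?], (wact v c) as [[? ?] ?]; simpl in *; congruence.
Qed.

(** * Reduced words and positive roots *)

Definition nonneg (a : vec) : Prop := forall s, 0 <= crd s a.

Fixpoint alt (s t : gen) (n : nat) : word :=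
  match n with O => [] | S n' => s :: alt t s n' end.

Definition braid (s t : gen) : nat :=
  match s, t with
  | s1, s2 | s2, s1 => 7
  | s2, s3 | s3, s2 => 3
  | _, _ => 2
  end.

Lemma alt_braid s t : s <> t -> delta_eq (alt s t (braid s t + braid s t)) [].
Proof.
intro H.
assert (P : In (alt s t (braid s t + braid s t)) relators \/
  In (rev (alt s t (braid s t + braid s t))) relators).
{ destruct s, t; try easy; simpl; tauto. }
destruct P as [P | P]; [now apply delta_relator |].
rewrite <- (rev_involutive (alt s t _)); now apply delta_rev_nil, delta_relator.
Qed.

Lemma length_alt s t n : length (alt s t n) = n.
Proof. revert s t; induction n; intros; simpl; auto. Qed.

Lemma alt_split s t n m : exists x, length x = m /\ alt s t (n + m) = alt s t n ++ x.
Proof.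
revert s t; induction n as [| n IH]; intros s t; simpl.
- exists (alt s t m); now rewrite length_alt.
- destruct (IH t s) as [x [L E]]; exists x; now rewrite E.
Qed.

(** An alternating word of length [braid s t + 1] is the inverse of the remaining [braid s t - 1]
    letters of the relator, hence not reduced. *)
Lemma reduced_alt s t n : s <> t -> reduced (alt s t n) -> (n <= braid s t)%nat.
Proof.
intros H Hr; apply Nat.nlt_ge; intro L.
assert (B : (1 < braid s t)%nat) by (destruct s, t; simpl; lia).
destruct (alt_split s t (S (braid s t)) (n - S (braid s t))) as [y [Ly Ey]].
replace (S (braid s t) + (n - S (braid s t)))%nat with n in Ey by lia.
rewrite Ey in Hr; apply reduced_app in Hr as [Hr _].
destruct (alt_split s t (S (braid s t)) (braid s t - 1)) as [x [Lx Ex]].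
replace (S (braid s t) + (braid s t - 1))%nat
  with (braid s t + braid s t)%nat in Ex by lia.
pose proof (alt_braid s t H) as E; rewrite Ex in E.
apply delta_solve_l, Hr in E; rewrite length_rev, length_alt in E; lia.
Qed.

Lemma reduced_two_letters s t w :
  s <> t -> (forall x, In x w -> x = s \/ x = t) -> reduced (s :: w) ->
  s :: w = alt s t (length (s :: w)).
Proof.
revert s t; induction w as [| x w IH]; intros s t Hst Hw Hr; [reflexivity |].
destruct (Hw x (or_introl eq_refl)) as [-> | ->].
- exfalso; pose proof (Hr _ (delta_cancel s w)) as L; simpl in L; lia.
- change (alt s t (length (s :: t :: w))) with (s :: alt t s (length (t :: w))).
  rewrite <- IH; auto.
  + intros x Hx; destruct (Hw x (or_intror Hx)); auto.
  + now apply reduced_cons in Hr.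
Qed.

(** The dihedral case, by exact computation for the at most seven values of n. The vanishing third
    coefficient matters: in a longer word the suffix may send the third simple root to a negative
    one. *)
Lemma alt_root_nonneg s t n :
  s <> t -> (S n <= braid s t)%nat ->
  nonneg (root_act (alt t s n) (simple s)) /\
  forall x, x <> s -> x <> t -> crd x (root_act (alt t s n) (simple s)) = 0.
Proof.
intros H L; rewrite <- vval_simple, <- vval_root_act.
assert (E : (forall x, znneg (crd x (zroot_act (alt t s n) (zsimple s))) = true) /\
  forall x, x <> s -> x <> t -> crd x (zroot_act (alt t s n) (zsimple s)) = zzero).
{ destruct s, t; try easy; simpl in L;
    do 7 (destruct n as [| n];
      [try (exfalso; lia); split; intros []; intros; first [reflexivity | congruence] |]);
    lia. }
destruct E as [E1 E2]; split.
- intro x; rewrite crd_vval; now apply znneg_spec.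
- intros x Hs Ht; rewrite crd_vval, E2 by easy; apply zval_zero.
Qed.

Lemma comb_nonneg a x y z :
  nonneg a -> (crd s1 a = 0 \/ nonneg x) -> (crd s2 a = 0 \/ nonneg y) ->
  (crd s3 a = 0 \/ nonneg z) -> nonneg (comb a x y z).
Proof.
intros Ha Hx Hy Hz s.
pose proof (Ha s1) as A1; pose proof (Ha s2) as A2; pose proof (Ha s3) as A3.
assert (K : forall (r : R) (v : vec), 0 <= r -> r = 0 \/ nonneg v -> 0 <= r * crd s v).
{ intros r v Hr [-> | Hv]; [lra | now apply Rmult_le_pos]. }
pose proof (K _ _ A1 Hx); pose proof (K _ _ A2 Hy); pose proof (K _ _ A3 Hz).
destruct a as [[a1 a2] a3], x as [[x1 x2] x3], y as [[y1 y2] y3], z as [[z1 z2] z3].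
destruct s; simpl in *; lra.
Qed.

(* Induction on the length: strip from [w] the longest possible prefix in the
   letters [s] and [t], where [t] is the first letter of [w]. What remains sends
   both simple roots to nonnegative ones by induction, and the prefix is an
   alternating word, hence covered by [alt_root_nonneg]. *)
Lemma reduced_root_nonneg s w : reduced (s :: w) -> nonneg (root_act w (simple s)).
Proof.
remember (length w) as n eqn:En.
revert s w En; induction n as [n IH] using lt_wf_ind; intros s w -> Hr.
destruct w as [| t w0] eqn:Ew.
{ intro x; destruct s, x; simpl; lra. }
assert (Hst : s <> t).
{ intros <-; pose proof (Hr _ (delta_cancel s w0)) as L; simpl in L; lia. }
assert (Claim : forall k v a, length v = k -> (forall x, In x a -> x = s \/ x = t) ->
  delta_eq w (a ++ v) -> (length a + length v = length w)%nat ->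
  (length v < length w)%nat -> nonneg (root_act w (simple s))).
{ intro k; induction k as [k IHk] using lt_wf_ind; intros v a <- Ha E L Lv.
  assert (Hw : reduced w) by (subst w; now apply reduced_cons in Hr).
  assert (Hav : reduced (a ++ v)).
  { apply (reduced_delta w); auto; now rewrite length_app. }
  destruct (reduced_app _ _ Hav) as [_ Hv].
  assert (Hstep : forall x, x = s \/ x = t -> reduced (x :: v) \/
     nonneg (root_act w (simple s))).
  { intros x Hx; destruct (classic (reduced (x :: v))) as [P | P]; [now left | right].
    destruct (not_reduced_cons x v Hv P) as [v' [E' L']].
    apply (IHk (length v') ltac:(lia) v' (a ++ [x])); auto.
    - intros y Hy; apply in_app_or in Hy as [Hy | [<- | []]]; auto.
    - rewrite <- app_assoc; eapply delta_trans; [exact E | now apply delta_app_l].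
    - rewrite length_app; simpl; lia.
    - lia. }
  destruct (Hstep s (or_introl eq_refl)) as [Rs | ?]; [| easy].
  destruct (Hstep t (or_intror eq_refl)) as [Rt | ?]; [| easy].
  pose proof (IH (length v) ltac:(subst w; lia) s v eq_refl Rs) as Ps.
  pose proof (IH (length v) ltac:(subst w; lia) t v eq_refl Rt) as Pt.
  rewrite (root_act_delta _ _ E), root_act_app, root_act_basis.
  assert (Hsa : reduced (s :: a)).
  { assert (G : reduced ((s :: a) ++ v)).
    { apply (reduced_delta (s :: w)); [subst w; exact Hr | now apply delta_cons |].
      simpl; rewrite length_app; lia. }
    now apply reduced_app in G. }
  pose proof (reduced_two_letters s t a Hst Ha Hsa) as Ea; simpl in Ea.
  injection Ea as Ea.
  assert (La : (S (length a) <= braid s t)%nat).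
  { apply reduced_alt; auto; simpl; now rewrite <- Ea. }
  destruct (alt_root_nonneg s t (length a) Hst La) as [N Z]; rewrite <- Ea in N, Z.
  assert (D : forall x, crd x (root_act a (simple s)) = 0 \/
    nonneg (root_act v (simple x))).
  { intro x; destruct (classic (x = s)) as [-> | X1]; [now right |].
    destruct (classic (x = t)) as [-> | X2]; [now right | left; now apply Z]. }
  now apply comb_nonneg. }
subst w; apply (Claim (length w0) w0 [t]); simpl; auto.
- intros x [<- | []]; auto.
- apply delta_refl.
Qed.

(** A point rather than a root: 0 lies on the walls 1 and 2, and its product with the third normal
    is scaled to 1. *)
Definition base : vec := simple s3.

(** [base] is dual to the third simple root, so this coordinate is a coefficient of the root w^-1
    (simple s), which is positive because the word is reduced. *)
Lemma reduced_ascending s w : reduced (s :: w) -> 0 <= crd s (wact w base).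
Proof.
intro H; rewrite <- dot_simple, dot_wact.
pose proof (reduced_root_nonneg s w H s3) as P.
destruct (root_act w (simple s)) as [[a1 a2] a3]; simpl in *; lra.
Qed.

(** * The action on ordered pairs of points of the projective line over F_8 *)

(* Delta maps onto PSL(2,8) x Z/2. The first factor permutes the 9 points of the
   projective line, the second one swaps the two entries of a pair. *)
Definition perm9 (s : gen) (a : nat) : nat :=
  nth a match s with
        | s1 => [6; 2; 1; 3; 8; 7; 0; 5; 4]
        | s2 => [6; 1; 7; 8; 5; 4; 0; 2; 3]
        | s3 => [5; 8; 4; 3; 2; 0; 7; 6; 1]
        end%nat O.

Notation colour := (nat * nat)%type.

Definition gen_col (s : gen) (x : colour) : colour := (perm9 s (snd x), perm9 s (fst x)).
Definition col (w : word) (x : colour) : colour := fold_right gen_col x w.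
Definition colours : list colour := list_prod (seq 0 9) (seq 0 9).
(** Both s1 and s2 exchange the points 0 and 6; together with the swap of the entries they fix this
    pair, so [col w base_colour] depends only on the orbit point w 0. *)
Definition base_colour : colour := (0, 6)%nat.

Definition col_eqb (x y : colour) : bool := (fst x =? fst y)%nat && (snd x =? snd y)%nat.

Lemma col_eqb_spec x y : col_eqb x y = true -> x = y.
Proof.
destruct x, y; unfold col_eqb; simpl; rewrite andb_true_iff, !Nat.eqb_eq.
intros [-> ->]; reflexivity.
Qed.

Definition fixes_all (w : word) : bool := forallb (fun x => col_eqb (col w x) x) colours.

Lemma fixes_all_spec w x : fixes_all w = true -> In x colours -> col w x = x.
Proof.
unfold fixes_all; rewrite forallb_forall; intros H Hx; now apply col_eqb_spec, H.
Qed.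

Lemma col_app u v x : col (u ++ v) x = col u (col v x).
Proof. apply fold_right_app. Qed.

Lemma gen_col_in s x : In x colours -> In (gen_col s x) colours.
Proof.
unfold colours; destruct x as [a b]; rewrite in_prod_iff; intros [Ha Hb].
unfold gen_col; apply in_prod_iff; rewrite in_seq in Ha, Hb; cbn [fst snd].
assert (P : forall a, (0 <= a < 0 + 9)%nat -> (0 <= perm9 s a < 0 + 9)%nat).
{ intros c Hc; do 9 (destruct c as [| c]; [destruct s; cbn; lia |]); lia. }
split; apply in_seq, P; assumption.
Qed.

Lemma col_in w x : In x colours -> In (col w x) colours.
Proof. intro H; induction w; simpl; [easy | now apply gen_col_in]. Qed.

(** The restriction to [colours] matters: outside the nine points [perm9] takes its default value 0
    and the relators fail. *)
Lemma col_delta u v : delta_eq u v -> forall x, In x colours -> col u x = col v x.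
Proof.
induction 1 as [r H | u u' v v' _ IH1 _ IH2 | | |]; intros x Hx; auto.
- apply fixes_all_spec; auto.
  simpl in H; decompose [or] H; subst; try contradiction; reflexivity.
- rewrite !col_app, IH2, IH1; auto using col_in.
- symmetry; auto.
- now rewrite IHdelta_eq1, IHdelta_eq2.
Qed.

Lemma fixes_all_gamma i : (1 <= i <= 42)%nat -> fixes_all (gamma i) = true.
Proof.
assert (E : forallb (fun i => fixes_all (gamma i)) (seq 1 42) = true)
  by (vm_compute; reflexivity).
rewrite forallb_forall in E; intro Hi; apply E, in_seq; lia.
Qed.

Lemma Gamma_fixes_colours g : Gamma g -> forall x, In x colours -> col g x = x.
Proof.
induction 1 as [i Hi | | u v _ IHu _ IHv | u _ IH | u v E _ IH]; intros x Hx.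
- now apply fixes_all_spec, Hx; apply fixes_all_gamma.
- reflexivity.
- now rewrite col_app, IHv, IHu.
- rewrite <- (IH x Hx) at 1; rewrite <- col_app.
  now rewrite (col_delta _ _ (delta_rev_l u) x Hx).
- now rewrite <- (col_delta _ _ E x Hx), IH.
Qed.

(** * The invariant form *)

(* A positive multiple of the Minkowski product, in the coordinates [crd]: the
   adjugate of twice the Gram matrix of the normals. *)
Definition form (c d : vec) : R :=
  let '(c1, c2, c3) := c in let '(d1, d2, d3) := d in
  c1 * (3 * d1 + 2 * mu * d2 + mu * d3) + c2 * (2 * mu * d1 + 4 * d2 + 2 * d3)
  + c3 * (mu * d1 + 2 * d2 + (4 - mu ^ 2) * d3).

Definition zdual (d : zvec) : zvec :=
  let '(d1, d2, d3) := d in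
  (zadd (zscale 3 d1) (zadd (zscale 2 (zmul_mu d2)) (zmul_mu d3)),
   zadd (zscale 2 (zmul_mu d1)) (zadd (zscale 4 d2) (zscale 2 d3)),
   zadd (zmul_mu d1) (zadd (zscale 2 d2) (zmul (4, 0, -1)%Z d3))).

Definition zdot (c a : zvec) : Zmu :=
  let '(c1, c2, c3) := c in let '(a1, a2, a3) := a in
  zadd (zmul c1 a1) (zadd (zmul c2 a2) (zmul c3 a3)).

Definition zform (c d : zvec) : Zmu := zdot c (zdual d).

Lemma zval_dot_dual c d : zval (zdot c (zdual d)) = form (vval c) (vval d).
Proof.
destruct c as [[c1 c2] c3], d as [[d1 d2] d3]; unfold zdot, zdual, vval, form.
rewrite !zval_add, !zval_mul, !zval_add, ?zval_mul, !zval_scale, !zval_mul_mu.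
change (zval (4, 0, -1)%Z) with (4 + 0 * mu + -1 * mu ^ 2); ring.
Qed.

Lemma form_sym c d : form c d = form d c.
Proof. destruct c as [[c1 c2] c3], d as [[d1 d2] d3]; simpl; ring. Qed.

Lemma form_refl_l s c d : form (refl s c) d = form c (refl s d).
Proof. destruct s, c as [[c1 c2] c3], d as [[d1 d2] d3]; simpl; ring. Qed.

Lemma refl_invol s c : refl s (refl s c) = c.
Proof. destruct s, c as [[c1 c2] c3]; simpl; vec_eq. Qed.

Lemma form_refl s c d : form (refl s c) (refl s d) = form c d.
Proof. now rewrite form_refl_l, refl_invol. Qed.

Lemma form_wact w c d : form (wact w c) (wact w d) = form c d.
Proof. induction w as [| s w IH]; simpl; [easy | now rewrite form_refl]. Qed.

Lemma mu_sq : 3 < mu ^ 2 < 4.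
Proof. pose proof mu_bounds; nra. Qed.

(** The factor 2 mu^2 - 6 is minus the determinant of twice the Gram matrix, positive because the
    group is hyperbolic: reflecting a point away from the chamber of p moves it away from p. *)
Lemma form_ascend p s c : nonneg p -> 0 <= crd s c -> form p c <= form p (refl s c).
Proof.
intros Hp Hc; specialize (Hp s); pose proof mu_sq.
pose proof (Rmult_le_pos _ _ Hp Hc).
enough (form p (refl s c) = form p c + (crd s p * crd s c) * (2 * mu ^ 2 - 6)) by nra.
destruct s, p as [[p1 p2] p3], c as [[c1 c2] c3]; simpl; ring.
Qed.

(** * Empty balls *)

Definition state : Type := (zvec * colour)%type.

Definition vec_eqb (x y : zvec) : bool :=
  let '(x1, x2, x3) := x in let '(y1, y2, y3) := y in
  zeqb x1 y1 && zeqb x2 y2 && zeqb x3 y3.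

Lemma vec_eqb_spec x y : vec_eqb x y = true -> x = y.
Proof.
destruct x as [[x1 x2] x3], y as [[y1 y2] y3]; unfold vec_eqb.
rewrite !andb_true_iff; intros [[H1 H2] H3].
now rewrite (zeqb_spec _ _ H1), (zeqb_spec _ _ H2), (zeqb_spec _ _ H3).
Qed.

Definition state_mem (x : state) (l : list state) : bool :=
  existsb (fun y => vec_eqb (fst x) (fst y) && col_eqb (snd x) (snd y)) l.

Lemma state_mem_spec x l : state_mem x l = true -> In x l.
Proof.
unfold state_mem; rewrite existsb_exists; intros [y [Hy E]].
apply andb_true_iff in E as [E1 E2]; apply vec_eqb_spec in E1; apply col_eqb_spec in E2.
destruct x, y; simpl in *; now subst.
Qed.

(* The ascending steps from [x] which stay below height [h], the height of a
   point [c] being [zdot c b]. *)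
Definition successors (b : zvec) (h : Zmu) (x : state) : list state :=
  let next s := (zrefl s (fst x), gen_col s (snd x)) in
  map next (filter (fun s => negb (zpos (zopp (crd s (fst x))))
                     && negb (znneg (zsub (zdot (fst (next s)) b) h))) [s1; s2; s3]).

(** An untrusted search: [empty_ball] tests afterwards that the resulting list contains the start
    and is closed under [successors], so soundness rests neither on the fuel nor on the order of the
    search. *)
Fixpoint explore (b : zvec) (h : Zmu) (fuel : nat) (todo seen : list state) : list state :=
  match fuel, todo with
  | S n, x :: todo' =>
      let new := filter (fun y => negb (state_mem y seen)) (successors b h x) in
      explore b h n (new ++ todo') (new ++ seen)
  | _, _ => seen
  end.

Definition zbase : zvec := zsimple s3.

(* The fuel 300 exceeds the number of states met for the centres used below. *)
Definition empty_ball (u : word) (v : zvec) : bool :=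
  let p := zwact u v in
  let b := zdual p in
  let h := zform v zbase in
  let start := (zbase, base_colour) in
  let l := if znneg (zsub (zdot zbase b) h) then [] else explore b h 300 [start] [start] in
  let x := col u base_colour in
  forallb (fun s => znneg (crd s p)) [s1; s2; s3]
  && (znneg (zsub (zdot zbase b) h) || state_mem start l)
  && forallb (fun y => negb (col_eqb (snd y) x)
                && forallb (fun z => state_mem z l) (successors b h y)) l.

Lemma vval_zbase : vval zbase = base.
Proof. apply vval_simple. Qed.

(** Read a reduced word for u g from its right end: the height over the moved centre never
    decreases, so a final height below h would put all intermediate states in the list. The last of
    them has the colour of u, which the list avoids. *)
Lemma empty_ball_spec u v :
  empty_ball u v = true ->
  forall g, col g base_colour = base_colour ->
  form (vval v) base <= form (vval v) (wact g base).
Proof.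
unfold empty_ball.
set (p := zwact u v); set (b := zdual p); set (h := zform v zbase).
generalize (if znneg (zsub (zdot zbase b) h) then []
  else explore b h 300 [(zbase, base_colour)] [(zbase, base_colour)]).
intros l H; rewrite !andb_true_iff, !forallb_forall in H.
destruct H as [[Hp Hstart] Hl].
assert (Np : nonneg (vval p)).
{ intro s; rewrite crd_vval; apply znneg_spec, Hp; destruct s; simpl; auto. }
assert (Hh : zval h = form (vval v) base).
{ unfold h, zform; now rewrite zval_dot_dual, vval_zbase. }
assert (Height : forall c, zval (zdot c b) = form (vval p) (vval c)).
{ intro c; unfold b; now rewrite zval_dot_dual, form_sym. }
assert (Main : forall w, reduced w ->
  In (zwact w zbase, col w base_colour) l \/
  zval h <= form (vval p) (vval (zwact w zbase))).
{ induction w as [| s w IH]; intro Hr.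
  - apply orb_true_iff in Hstart as [E | E].
    + right; apply znneg_spec in E; rewrite zval_sub, Height in E; cbn [zwact fold_right]; lra.
    + left; now apply state_mem_spec.
  - pose proof (reduced_ascending s w Hr) as A.
    rewrite <- vval_zbase, <- vval_wact in A.
    destruct (IH (reduced_cons _ _ Hr)) as [I | I].
    + set (y := (zwact w zbase, col w base_colour)) in *.
      destruct (zpos (zopp (crd s (fst y)))) eqn:E1.
      { apply zpos_spec in E1; rewrite zval_opp, <- crd_vval in E1; simpl in E1; lra. }
      destruct (znneg (zsub (zdot (zrefl s (fst y)) b) h)) eqn:E2.
      { right; apply znneg_spec in E2; rewrite zval_sub, Height in E2; unfold y in E2.
        change (zwact (s :: w) zbase) with (zrefl s (zwact w zbase)).
        cbn [fst] in E2; lra. }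
      left; apply Hl in I; rewrite andb_true_iff, forallb_forall in I.
      destruct I as [_ I]; apply state_mem_spec, I.
      unfold successors; apply in_map_iff; exists s; split; [reflexivity |].
      apply filter_In; split; [destruct s; simpl; auto |].
      cbn [fst snd]; now rewrite E1, E2.
    + right; simpl; rewrite vval_refl.
      eapply Rle_trans; [exact I | now apply form_ascend]. }
intros g Hg; destruct (exists_reduced (u ++ g)) as [w [E Hr]].
rewrite <- Hh, <- (form_wact u (vval v) (wact g base)), <- vval_wact, <- wact_app; fold p.
rewrite (wact_delta _ _ E), <- vval_zbase, <- vval_wact.
destruct (Main w Hr) as [I | I]; [exfalso | exact I].
apply Hl in I; rewrite andb_true_iff in I; destruct I as [I _].
assert (B : In base_colour colours) by (simpl; tauto).
cbn [snd] in I; rewrite <- (col_delta _ _ E _ B), col_app, Hg in I.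
unfold col_eqb in I; now rewrite !Nat.eqb_refl in I.
Qed.

(** * The cone of the polygon *)

(* [wact (rev (gamma i)) base] is the orbit point gamma_i^-1 0. *)
Definition neighbour (i : nat) : vec := wact (rev (gamma i)) base.
Definition zneighbour (i : nat) : zvec := zwact (rev (gamma i)) zbase.

Lemma vval_zneighbour i : vval (zneighbour i) = neighbour i.
Proof. unfold zneighbour, neighbour; now rewrite vval_wact, vval_zbase. Qed.

Definition in_sides (v : vec) : Prop :=
  forall i, (1 <= i <= 42)%nat -> form v base <= form v (neighbour i).

(** The symmetry of order 14 of the polygon: it allows the sides to be examined in a single
    sector. *)
Lemma refl_neighbour s i :
  s = s1 \/ s = s2 -> (1 <= i <= 42)%nat ->
  exists j, (1 <= j <= 42)%nat /\ refl s (neighbour i) = neighbour j.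
Proof.
assert (E : forallb (fun s => forallb (fun x => existsb (vec_eqb (zrefl s x))
   (map zneighbour (seq 1 42))) (map zneighbour (seq 1 42))) [s1; s2] = true)
  by (vm_compute; reflexivity).
intros Hs Hi; rewrite forallb_forall in E.
assert (E' := E s ltac:(destruct Hs as [-> | ->]; simpl; auto)).
rewrite forallb_forall in E'.
assert (I : In (zneighbour i) (map zneighbour (seq 1 42))).
{ apply in_map, in_seq; lia. }
apply E', existsb_exists in I as [y [Hy Ey]]; apply vec_eqb_spec in Ey.
apply in_map_iff in Hy as [j [<- Hj]]; apply in_seq in Hj.
exists j; split; [lia |]; now rewrite <- !vval_zneighbour, <- vval_refl, Ey.
Qed.

Lemma refl_base s : s = s1 \/ s = s2 -> refl s base = base.
Proof. intros [-> | ->]; unfold base; simpl; vec_eq. Qed.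

Lemma wact_rotation_base d : (forall x, In x d -> x = s1 \/ x = s2) -> wact d base = base.
Proof.
induction d as [| s d IH]; intro H; [reflexivity |]; simpl.
rewrite IH by (intros; apply H; now right).
now apply refl_base, H; left.
Qed.

Lemma col_rotation_base d :
  (forall x, In x d -> x = s1 \/ x = s2) -> col d base_colour = base_colour.
Proof.
induction d as [| s d IH]; intro H; [reflexivity |]; simpl.
rewrite IH by (intros; apply H; now right).
destruct (H s (or_introl eq_refl)) as [-> | ->]; reflexivity.
Qed.

Lemma in_sides_rotation d v :
  (forall x, In x d -> x = s1 \/ x = s2) -> in_sides v -> in_sides (wact d v).
Proof.
intros H Hv; induction d as [| s d IH]; [exact Hv |].
assert (Hd := IH (fun x Hx => H x (or_intror Hx))).
pose proof (H s (or_introl eq_refl)) as Hs.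
intros i Hi; destruct (refl_neighbour s i Hs Hi) as [j [Hj E]]; simpl.
rewrite !form_refl_l, E.
replace (refl s base) with base by (symmetry; now apply refl_base).
now apply Hd.
Qed.

(** * Rotation into the sector between the walls 1 and 2 *)

Lemma sign_change (u : nat -> R) n :
  u O <= 0 -> 0 <= u (S n) -> exists k, u k <= 0 <= u (S k).
Proof.
intros H0; induction n as [| n IH]; intro H; [now exists O |].
destruct (Rle_dec (u (S n)) 0) as [L | L]; [now exists (S n) |].
apply IH; lra.
Qed.

Fixpoint rotation_word (n : nat) : word :=
  match n with
  | O => []
  | S n' => (if Nat.even n' then s1 else s2) :: rotation_word n'
  end.

(** As mu = 2 cos (pi / 7), this is a sinusoid sampled at step pi / 7: it changes sign after 7
    steps. Its terms are the products of a vector with the normals of the successive mirrors through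
    0. *)
Fixpoint rotation_seq (x y : R) (n : nat) : R :=
  match n with O => x | S n' => rotation_seq y (mu * y - x) n' end.

Lemma rotation_seq_rec n x y :
  rotation_seq x y (S (S n)) = mu * rotation_seq x y (S n) - rotation_seq x y n.
Proof.
revert x y; induction n as [| n IH]; intros x y; [reflexivity |].
change (rotation_seq x y (S (S (S n)))) with (rotation_seq y (mu * y - x) (S (S n))).
now rewrite IH.
Qed.

Lemma rotation_seq_7 n x y : rotation_seq x y (n + 7) = - rotation_seq x y n.
Proof.
revert x y; induction n as [| n IH]; intros x y; [| apply IH].
pose proof mu_eq as E.
assert (Y2 : rotation_seq x y 2 = mu * y - x) by reflexivity.
assert (Y3 : rotation_seq x y 3 = (mu ^ 2 - 1) * y - mu * x).
{ rewrite rotation_seq_rec, Y2; simpl; ring. }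
assert (Y4 : rotation_seq x y 4 = (mu ^ 2 - 1) * y - (mu ^ 2 - 1) * x).
{ rewrite rotation_seq_rec, Y3, Y2.
  replace (mu * ((mu ^ 2 - 1) * y - mu * x)) with (mu ^ 3 * y - mu * y - mu ^ 2 * x) by ring.
  rewrite E; ring. }
assert (Y5 : rotation_seq x y 5 = mu * y - (mu ^ 2 - 1) * x).
{ rewrite rotation_seq_rec, Y4, Y3.
  replace (mu * ((mu ^ 2 - 1) * y - (mu ^ 2 - 1) * x))
    with ((mu ^ 3 - mu) * y - (mu ^ 3 - mu) * x) by ring.
  rewrite E; ring. }
assert (Y6 : rotation_seq x y 6 = y - mu * x).
{ rewrite rotation_seq_rec, Y5, Y4.
  replace (mu * (mu * y - (mu ^ 2 - 1) * x))
    with (mu ^ 2 * y - (mu ^ 3 - mu) * x) by ring.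
  rewrite E; ring. }
change (0 + 7)%nat with 7%nat; rewrite rotation_seq_rec, Y6, Y5; simpl; ring.
Qed.

(** Consecutive terms of one sequence appear as the first two coordinates, with signs such that the
    sector is reached exactly where the sequence passes from nonpositive to nonnegative. *)
Lemma wact_rotation_word n c1 c2 c3 :
  let y := rotation_seq (- c2) c1 in
  exists c3', wact (rotation_word n) (c1, c2, c3) =
    if Nat.even n then (y (S n), - y n, c3') else (- y n, y (S n), c3').
Proof.
intro y; induction n as [| n [c3' IH]].
- exists c3; unfold y; simpl; vec_eq.
- assert (Y : y (S (S n)) = mu * y (S n) - y n) by apply rotation_seq_rec.
  cbn [rotation_word wact fold_right]; fold (wact (rotation_word n)).
  rewrite Nat.even_succ, <- Nat.negb_even, Y.
  change (fold_right refl (c1, c2, c3) (rotation_word n))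
    with (wact (rotation_word n) (c1, c2, c3)).
  rewrite IH; destruct (Nat.even n); cbn [refl negb].
  + exists c3'; vec_eq.
  + eexists; vec_eq; reflexivity.
Qed.

Lemma rotation_word_letters n x : In x (rotation_word n) -> x = s1 \/ x = s2.
Proof.
induction n as [| n IH]; simpl; [easy |].
intros [<- | H]; [destruct (Nat.even n); auto | auto].
Qed.

Lemma rotate_into_sector v :
  exists d, (forall x, In x d -> x = s1 \/ x = s2) /\
    0 <= crd s1 (wact d v) /\ 0 <= crd s2 (wact d v).
Proof.
destruct v as [[c1 c2] c3]; set (y := rotation_seq (- c2) c1).
assert (P : forall n, y (n + 7)%nat = - y n) by (intro; apply rotation_seq_7).
assert (K : exists k, y k <= 0 <= y (S k)).
{ destruct (Rle_dec (y O) 0) as [L | L].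
  - apply (sign_change y 6 L); pose proof (P O) as H; simpl in H; rewrite H; lra.
  (* Here y 0 is positive, so y 7 is negative and y 14 = y 0: the change is found in the second half
     turn. *)
  - destruct (sign_change (fun k => y (7 + k)%nat) 6) as [k Hk].
    + pose proof (P O) as H; simpl in H |- *; rewrite H; lra.
    + pose proof (P 7%nat) as H; pose proof (P O) as H'; simpl in H, H' |- *.
      rewrite H, H'; lra.
    + exists (7 + k)%nat; now rewrite <- Nat.add_succ_r. }
destruct K as [k Hk]; exists (rotation_word k); split; [apply rotation_word_letters |].
destruct (wact_rotation_word k c1 c2 c3) as [c3' ->]; fold y.
destruct (Nat.even k); simpl; lra.
Qed.

(** * The Dirichlet inequalities on the cone *)

(* [p] and [q] span, together with [base], the cone over a triangle cut off by
   the side [i] of the polygon; [u] and [u'] carry [p] and [q] into the fundamental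
   chamber. *)
Definition triangle_check (u : word) (p : zvec) (u' : word) (q : zvec) (i : nat) : bool :=
  empty_ball u p && empty_ball u' q
  && zpos (zsub (zmul (crd s2 p) (crd s1 q)) (zmul (crd s1 p) (crd s2 q)))
  && zeqb (zform p (zneighbour i)) (zform p zbase)
  && zeqb (zform q (zneighbour i)) (zform q zbase)
  && zpos (zsub (zform zbase (zneighbour i)) (zform zbase zbase))
  && zpos (zform p p) && zpos (zform q q) && zpos (zform p q)
  && zpos (zform p zbase) && zpos (zform q zbase).

Lemma zval_form c d : zval (zform c d) = form (vval c) (vval d).
Proof. apply zval_dot_dual. Qed.

Lemma form_comb D v a p b q c r :
  (forall s, D * crd s v = a * crd s p + b * crd s q + c * crd s r) ->
  forall w, D * form v w = a * form p w + b * form q w + c * form r w.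
Proof.
intros H w; pose proof (H s1) as H1; pose proof (H s2) as H2; pose proof (H s3) as H3.
destruct v as [[v1 v2] v3], p as [[p1 p2] p3], q as [[q1 q2] q3], r as [[r1 r2] r3],
  w as [[w1 w2] w3]; simpl in *.
replace (D * (v1 * (3 * w1 + 2 * mu * w2 + mu * w3) + v2 * (2 * mu * w1 + 4 * w2 + 2 * w3)
  + v3 * (mu * w1 + 2 * w2 + (4 - mu * (mu * 1)) * w3)))
  with (D * v1 * (3 * w1 + 2 * mu * w2 + mu * w3)
  + D * v2 * (2 * mu * w1 + 4 * w2 + 2 * w3)
  + D * v3 * (mu * w1 + 2 * w2 + (4 - mu * (mu * 1)) * w3)) by ring.
rewrite H1, H2, H3; ring.
Qed.

Lemma form_base_base : form base base = 4 - mu ^ 2.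
Proof. unfold base; simpl; ring. Qed.

(** The colour condition on g, unlike membership in Gamma, is stable under multiplication by s1 and
    s2. The second clause is what keeps the polygon off the unit circle. *)
Definition dirichlet_cone (v : vec) : Prop :=
  (forall g, col g base_colour = base_colour -> form v base <= form v (wact g base)) /\
  (form v v <= 0 -> v = (0, 0, 0)).

(** No point is closer to 0 than 0 itself: the ball of radius zero, put through the same test. *)
Lemma base_dirichlet g :
  col g base_colour = base_colour -> form base base <= form base (wact g base).
Proof.
rewrite <- vval_zbase at 1 3; rewrite <- vval_zbase at 1.
revert g; assert (E : empty_ball [] zbase = true) by (vm_compute; reflexivity).
intros g Hg; pose proof (empty_ball_spec _ _ E g Hg) as H.
now rewrite vval_zbase in *.
Qed.

(** Cramer's rule gives D v = a base + b p + c q. The first two coordinates of [base] vanish, so b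
    and c are 2 x 2 minors, nonnegative by the last two hypotheses; a >= 0 is the inequality of side
    i, since p and q lie on that side and 0 strictly inside. The Dirichlet inequalities are then
    added up. All products among base, p and q are positive, so form v v <= 0 forces a = b = c =
    0. *)
Lemma triangle_dirichlet u p u' q i v :
  triangle_check u p u' q i = true ->
  form v base <= form v (neighbour i) ->
  0 <= crd s2 (vval p) * crd s1 v - crd s1 (vval p) * crd s2 v ->
  crd s2 (vval q) * crd s1 v - crd s1 (vval q) * crd s2 v <= 0 ->
  dirichlet_cone v.
Proof.
unfold triangle_check; rewrite !andb_true_iff.
intros [[[[[[[[[[Bp Bq] HD] Fp] Fq] Fb] Fpp] Fqq] Fpq] Fpb] Fqb] Hv Cp Cq.
pose proof (empty_ball_spec _ _ Bp) as Gp; pose proof (empty_ball_spec _ _ Bq) as Gq.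
apply zpos_spec in HD, Fb, Fpp, Fqq, Fpq, Fpb, Fqb.
apply zeqb_spec, (f_equal zval) in Fp, Fq.
rewrite zval_sub, !zval_mul, <- !crd_vval in HD.
rewrite zval_sub in Fb.
rewrite !zval_form, ?vval_zneighbour, ?vval_zbase in *.
revert HD Fp Fq Fpp Fqq Fpq Fpb Fqb Gp Gq Cp Cq.
generalize (vval p) (vval q); clear p q Bp Bq; intros p q.
intros HD Fp Fq Fpp Fqq Fpq Fpb Fqb Gp Gq Cp Cq.
set (D := crd s2 p * crd s1 q - crd s1 p * crd s2 q) in *.
set (b := - (crd s2 q * crd s1 v - crd s1 q * crd s2 v)).
set (c := crd s2 p * crd s1 v - crd s1 p * crd s2 v) in *.
set (a := D * crd s3 v - b * crd s3 p - c * crd s3 q).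
assert (E : forall s, D * crd s v = a * crd s base + b * crd s p + c * crd s q).
{ unfold a, b, c, D, base; intro s.
  destruct s, p as [[p1 p2] p3], q as [[q1 q2] q3], v as [[v1 v2] v3]; simpl; ring. }
pose proof (form_comb _ _ _ _ _ _ _ _ E) as FE.
assert (Hb : 0 <= b) by (unfold b; lra).
assert (Ha : 0 <= a).
{ pose proof (FE base) as E1; pose proof (FE (neighbour i)) as E2.
  rewrite Fp, Fq in E2.
  assert (0 <= D * (form v (neighbour i) - form v base)) by (apply Rmult_le_pos; lra).
  assert (0 <= a * (form base (neighbour i) - form base base)) by lra.
  nra. }
split.
- intros g Hg; apply Rmult_le_reg_l with D; [exact HD |].
  rewrite !FE; pose proof (base_dirichlet g Hg); pose proof (Gp g Hg); pose proof (Gq g Hg).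
  assert (0 <= a * (form base (wact g base) - form base base)) by (apply Rmult_le_pos; lra).
  assert (0 <= b * (form p (wact g base) - form p base)) by (apply Rmult_le_pos; lra).
  assert (0 <= c * (form q (wact g base) - form q base)) by (apply Rmult_le_pos; lra).
  lra.
- intro N.
  assert (Fbb : 0 < form base base) by (rewrite form_base_base; pose proof mu_sq; lra).
  assert (Q : D * (D * form v v) =
    a * (a * form base base + b * form p base + c * form q base)
    + b * (a * form p base + b * form p p + c * form p q)
    + c * (a * form q base + b * form p q + c * form q q)).
  { rewrite FE.
    rewrite Rmult_plus_distr_l, Rmult_plus_distr_l.
    replace (D * (a * form base v)) with (a * (D * form v base))
      by (rewrite (form_sym base v); ring).
    replace (D * (b * form p v)) with (b * (D * form v p)) by (rewrite (form_sym p v); ring).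
    replace (D * (c * form q v)) with (c * (D * form v q)) by (rewrite (form_sym q v); ring).
    rewrite !FE, (form_sym base p), (form_sym base q), (form_sym q p); ring. }
  assert (N' : D * (D * form v v) <= 0) by nra.
  assert (Hab : 0 <= a * b) by now apply Rmult_le_pos.
  assert (Hac : 0 <= a * c) by now apply Rmult_le_pos.
  assert (Hbc : 0 <= b * c) by now apply Rmult_le_pos.
  assert (K : forall x f, 0 < f -> 0 <= x -> 0 <= x * f) by (intros; apply Rmult_le_pos; lra).
  pose proof (K _ _ Fpb Hab); pose proof (K _ _ Fqb Hac); pose proof (K _ _ Fpq Hbc).
  pose proof (K _ _ Fbb (Rle_0_sqr a)); pose proof (K _ _ Fpp (Rle_0_sqr b)).
  pose proof (K _ _ Fqq (Rle_0_sqr c)); unfold Rsqr in *.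
  assert (Z : forall x f, 0 < f -> x * x * f = 0 -> x = 0).
  { intros x f Hf Hx; apply Rmult_integral in Hx as [Hx | Hx]; nra. }
  assert (a = 0) by (apply (Z _ _ Fbb); lra).
  assert (b = 0) by (apply (Z _ _ Fpp); lra).
  assert (c = 0) by (apply (Z _ _ Fqq); lra).
  assert (V : forall s, crd s v = 0).
  { intro s; apply Rmult_eq_reg_l with D; [rewrite E | lra].
    replace a with 0; replace b with 0; replace c with 0; ring. }
  pose proof (V s1); pose proof (V s2); pose proof (V s3).
  destruct v as [[v1 v2] v3]; simpl in *; congruence.
Qed.

(* In the sector between the walls 1 and 2 the polygon has the vertices [vtx1],
   [vtx2], [vtx3] and the sides 29, ..., 32; [vtx0] and [vtx4] are the points where the
   sides 29 and 32 meet the walls. All are scaled to have entries in [Z[mu]]. *)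
Definition vtx0 : zvec := ((0, 0, 0), (1, -1, 1), (0, 0, -1))%Z.
Definition vtx1 : zvec := ((-6, 0, 2), (2, 0, 0), (0, 0, -1))%Z.
Definition vtx2 : zvec := ((2, 0, 0), (-2, 2, 0), (1, -3, 0))%Z.
Definition vtx3 : zvec := ((-2, 2, 2), (2, 0, 0), (0, -1, -3))%Z.
Definition vtx4 : zvec := ((-2, 1, 1), (0, 0, 0), (0, 0, -1))%Z.

(** Each word carries the vector of the same index to one with nonnegative coordinates; the test in
    [empty_ball] certifies it. *)
Definition mov0 : word := [s3; s2; s1; s2; s3; s1; s2; s1; s2; s1; s2; s3].
Definition mov1 : word :=
  [s1; s2; s1; s2; s3; s2; s1; s2; s1; s2; s3; s1; s2; s1; s2; s1; s2; s3].
Definition mov2 : word :=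
  [s3; s2; s1; s2; s3; s1; s2; s1; s2; s3; s2; s1; s2; s1; s2; s3; s2; s1; s2; s1; s2; s3].
Definition mov3 : word := [s3; s1; s2; s1; s2; s3; s1; s2; s1; s2; s3; s1; s2; s1; s2; s3].
Definition mov4 : word := [s3; s2; s1; s2; s1; s2; s3; s1; s2; s1; s2; s3].

Lemma sector_dirichlet v :
  0 <= crd s1 v -> 0 <= crd s2 v -> in_sides v -> dirichlet_cone v.
Proof.
intros H1 H2 Hv.
assert (T0 : triangle_check mov0 vtx0 mov1 vtx1 29 = true) by (vm_compute; reflexivity).
assert (T1 : triangle_check mov1 vtx1 mov2 vtx2 30 = true) by (vm_compute; reflexivity).
assert (T2 : triangle_check mov2 vtx2 mov3 vtx3 31 = true) by (vm_compute; reflexivity).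
assert (T3 : triangle_check mov3 vtx3 mov4 vtx4 32 = true) by (vm_compute; reflexivity).
pose proof mu_bounds; pose proof mu_sq.
assert (C : forall i, (1 <= i <= 42)%nat -> form v base <= form v (neighbour i)) by auto.
(* The sign of [l p] tells on which side of the ray from 0 through p the vector v lies; the first
   change of sign from [vtx0] to [vtx4] selects the triangle. *)
set (l (p : zvec) := crd s2 (vval p) * crd s1 v - crd s1 (vval p) * crd s2 v).
assert (L0 : 0 <= l vtx0).
{ unfold l, vtx0; simpl.
  assert (0 <= (1 + -1 * mu + 1 * (mu * (mu * 1))) * crd s1 v) by (apply Rmult_le_pos; nra).
  lra. }
assert (L4 : l vtx4 <= 0).
{ unfold l, vtx4; simpl.
  assert (0 <= (-2 + 1 * mu + 1 * (mu * (mu * 1))) * crd s2 v) by (apply Rmult_le_pos; nra).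
  lra. }
destruct (Rle_dec (l vtx1) 0) as [L1 | L1].
{ apply (triangle_dirichlet _ _ _ _ _ v T0); auto; apply C; lia. }
apply Rnot_le_lt, Rlt_le in L1.
destruct (Rle_dec (l vtx2) 0) as [L2 | L2].
{ apply (triangle_dirichlet _ _ _ _ _ v T1); auto; apply C; lia. }
apply Rnot_le_lt, Rlt_le in L2.
destruct (Rle_dec (l vtx3) 0) as [L3 | L3].
{ apply (triangle_dirichlet _ _ _ _ _ v T2); auto; apply C; lia. }
apply Rnot_le_lt, Rlt_le in L3.
apply (triangle_dirichlet _ _ _ _ _ v T3); auto; apply C; lia.
Qed.

Lemma wact_rev_l d c : wact (rev d) (wact d c) = c.
Proof. rewrite <- wact_app; now rewrite (wact_delta _ _ (delta_rev_l d)). Qed.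

Lemma in_sides_dirichlet v : in_sides v -> dirichlet_cone v.
Proof.
intro Hv; destruct (rotate_into_sector v) as [d [Hd [P1 P2]]].
destruct (sector_dirichlet _ P1 P2 (in_sides_rotation d v Hd Hv)) as [G N].
split.
- intros g Hg.
  rewrite <- (form_wact d v base), <- (form_wact d v (wact g base)), <- wact_app.
  rewrite (wact_rotation_base d Hd); apply G.
  now rewrite col_app, Hg, (col_rotation_base d Hd).
- intro H; rewrite <- (wact_rev_l d v), N by now rewrite form_wact.
  clear; induction (rev d) as [| s w IH]; simpl; [easy | rewrite IH].
  destruct s; simpl; vec_eq.
Qed.

(** * The disk in the coordinates [crd] *)

Definition sn : R := sin (PI / 7).
(** The distance from 0 to wall 3 in the Klein model. Its foot there is P1, whence dl = 2 r0 / (1 +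
    r0^2), as [r0_dl] shows. *)
Definition dl : R := sqrt (mu ^ 2 - 3).

Lemma sn_pos : 0 < sn.
Proof. apply sin_gt_0; pose proof PI_RGT_0; lra. Qed.

Lemma sn_sq : 4 * sn ^ 2 = 4 - mu ^ 2.
Proof. pose proof (sin2_cos2 (PI / 7)) as H; unfold sn, mu, Rsqr in *; nra. Qed.

Lemma dl_pos : 0 < dl.
Proof. apply sqrt_lt_R0; pose proof mu_sq; lra. Qed.

Lemma dl_sq : dl ^ 2 = mu ^ 2 - 3.
Proof. unfold dl; rewrite pow2_sqrt; [easy | pose proof mu_sq; lra]. Qed.

Lemma dl_sn : dl ^ 2 = 1 - 4 * sn ^ 2.
Proof. rewrite dl_sq, sn_sq; ring. Qed.

(** Dividing the reciprocal polynomial by r^6 gives a cubic in u = r^2 + / r^2, and 0 < r < 1 means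
    u > 2. *)
Lemma palindromic_root r u0 b c :
  0 < r < 1 -> 2 < u0 ->
  (forall u, 2 < u -> u ^ 3 - 6 * u ^ 2 + b * u + c = 0 -> u = u0) ->
  1 - 6 * r ^ 2 + (b + 3) * r ^ 4 + (c - 12) * r ^ 6 + (b + 3) * r ^ 8 - 6 * r ^ 10 + r ^ 12 = 0 ->
  1 + r ^ 4 = u0 * r ^ 2.
Proof.
intros Hr Hu U E.
assert (H2 : 0 < r ^ 2) by nra.
assert (P : 2 < r ^ 2 + / r ^ 2).
{ apply Rmult_lt_reg_r with (r ^ 2); [easy |].
  replace ((r ^ 2 + / r ^ 2) * r ^ 2) with (r ^ 4 + 1) by (field; lra).
  assert (0 < (1 - r ^ 2) * (1 - r ^ 2)) by (apply Rmult_lt_0_compat; nra); nra. }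
rewrite <- (U _ P); [field; lra |].
apply Rmult_eq_reg_r with (r ^ 6); [| apply pow_nonzero; lra].
transitivity (1 - 6 * r ^ 2 + (b + 3) * r ^ 4 + (c - 12) * r ^ 6 + (b + 3) * r ^ 8
  - 6 * r ^ 10 + r ^ 12); [field; lra | rewrite E; ring].
Qed.

Lemma cubic_root_unique b c u0 u :
  u0 ^ 3 - 6 * u0 ^ 2 + b * u0 + c = 0 -> u ^ 3 - 6 * u ^ 2 + b * u + c = 0 ->
  0 < u ^ 2 + (u0 - 6) * u + (u0 ^ 2 - 6 * u0 + b) -> u = u0.
Proof.
intros H0 H P.
assert (E : (u - u0) * (u ^ 2 + (u0 - 6) * u + (u0 ^ 2 - 6 * u0 + b)) = 0).
{ replace 0 with ((u ^ 3 - 6 * u ^ 2 + b * u + c) - (u0 ^ 3 - 6 * u0 ^ 2 + b * u0 + c))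
    by lra; ring. }
apply Rmult_integral in E as [E | E]; lra.
Qed.

Lemma r0_dl r : is_r0 r -> dl * (1 + r ^ 2) = 2 * r.
Proof.
intros [[Hr0 Hr1] E]; pose proof mu_bounds as [B0 B1]; pose proof mu_eq as M; pose proof dl_pos.
(* The root of the cubic beyond 2, written in Z[mu]: u0 + 2 = ((1 + r^2) / r)^2 has to be 4 /
   dl^2. *)
set (u0 := 4 * mu ^ 2 + 4 * mu - 6).
assert (C0 : u0 ^ 3 - 6 * u0 ^ 2 + -100 * u0 + -232 = 0).
{ pose (z := (-6, 4, 4)%Z : Zmu).
  assert (Z : zval z = u0) by (unfold z, u0, zval; ring).
  assert (E0 : zadd (zmul z (zmul z z)) (zadd (zscale (-6) (zmul z z))
     (zadd (zscale (-100) z) (-232, 0, 0)%Z)) = zzero) by reflexivity.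
  apply (f_equal zval) in E0.
  rewrite !zval_add, !zval_mul, !zval_scale, zval_mul, Z, zval_zero in E0.
  change (zval (-232, 0, 0)%Z) with (-232 + 0 * mu + 0 * mu ^ 2) in E0.
  rewrite <- E0; ring. }
assert (U0 : 14 < u0) by (unfold u0; nra).
assert (P : 1 + r ^ 4 = u0 * r ^ 2).
{ apply palindromic_root with (b := -100) (c := -232); try lra.
  intros u Hu Eu; apply (cubic_root_unique _ _ _ _ C0 Eu); nra. }
assert (D : dl ^ 2 * (u0 + 2) = 4).
{ rewrite dl_sq; unfold u0.
  replace ((mu ^ 2 - 3) * (4 * mu ^ 2 + 4 * mu - 6 + 2))
    with (4 * mu * mu ^ 3 + 4 * mu ^ 3 - 16 * mu ^ 2 - 12 * mu + 12) by ring.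
  rewrite M.
  replace (4 * mu * (mu ^ 2 + 2 * mu - 1)) with (4 * mu ^ 3 + 8 * mu ^ 2 - 4 * mu) by ring.
  rewrite M; ring. }
assert (Q : (dl * (1 + r ^ 2)) ^ 2 = (2 * r) ^ 2).
{ replace ((dl * (1 + r ^ 2)) ^ 2) with (dl ^ 2 * (1 + r ^ 4 + 2 * r ^ 2)) by ring.
  rewrite P.
  replace (dl ^ 2 * (u0 * r ^ 2 + 2 * r ^ 2)) with (dl ^ 2 * (u0 + 2) * r ^ 2) by ring.
  rewrite D; ring. }
assert (0 < dl * (1 + r ^ 2)) by (apply Rmult_lt_0_compat; nra).
apply Rsqr_inj; [lra | lra | now rewrite !Rsqr_pow2].
Qed.

(** In the Klein model P2 is at distance dl / cos (pi / 7) from 0: the hypotenuse of a Euclidean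
    right triangle with leg dl and angle pi / 7. *)
Lemma y0_dl y : is_y0 y -> dl * (1 + y ^ 2) = mu * y.
Proof.
intros [[Hr0 Hr1] E]; pose proof mu_bounds as [B0 B1]; pose proof mu_eq as M; pose proof dl_pos.
set (u0 := 3 * mu ^ 2 + 3 * mu - 4).
assert (C0 : u0 ^ 3 - 6 * u0 ^ 2 + -51 * u0 + -71 = 0).
{ pose (z := (-4, 3, 3)%Z : Zmu).
  assert (Z : zval z = u0) by (unfold z, u0, zval; ring).
  assert (E0 : zadd (zmul z (zmul z z)) (zadd (zscale (-6) (zmul z z))
     (zadd (zscale (-51) z) (-71, 0, 0)%Z)) = zzero) by reflexivity.
  apply (f_equal zval) in E0.
  rewrite !zval_add, !zval_mul, !zval_scale, zval_mul, Z, zval_zero in E0.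
  change (zval (-71, 0, 0)%Z) with (-71 + 0 * mu + 0 * mu ^ 2) in E0.
  rewrite <- E0; ring. }
assert (U0 : 11 < u0) by (unfold u0; nra).
assert (P : 1 + y ^ 4 = u0 * y ^ 2).
{ apply palindromic_root with (b := -51) (c := -71); try lra.
  intros u Hu Eu; apply (cubic_root_unique _ _ _ _ C0 Eu); nra. }
assert (D : dl ^ 2 * (u0 + 2) = mu ^ 2).
{ rewrite dl_sq; unfold u0.
  replace ((mu ^ 2 - 3) * (3 * mu ^ 2 + 3 * mu - 4 + 2))
    with (3 * mu * mu ^ 3 + 3 * mu ^ 3 - 11 * mu ^ 2 - 9 * mu + 6) by ring.
  rewrite M.
  replace (3 * mu * (mu ^ 2 + 2 * mu - 1)) with (3 * mu ^ 3 + 6 * mu ^ 2 - 3 * mu) by ring.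
  rewrite M; ring. }
assert (Q : (dl * (1 + y ^ 2)) ^ 2 = (mu * y) ^ 2).
{ replace ((dl * (1 + y ^ 2)) ^ 2) with (dl ^ 2 * (1 + y ^ 4 + 2 * y ^ 2)) by ring.
  rewrite P.
  replace (dl ^ 2 * (u0 * y ^ 2 + 2 * y ^ 2)) with (dl ^ 2 * (u0 + 2) * y ^ 2) by ring.
  rewrite D; ring. }
assert (0 < dl * (1 + y ^ 2)) by (apply Rmult_lt_0_compat; nra).
assert (0 < mu * y) by (apply Rmult_lt_0_compat; lra).
apply Rsqr_inj; [lra | lra | now rewrite !Rsqr_pow2].
Qed.

(** * Moebius transformations *)

Definition norm2 (z : C) : R := Re z ^ 2 + Im z ^ 2.

Lemma norm2_Cmod z : Cmod z ^ 2 = norm2 z.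
Proof. apply Cmod2_alt. Qed.

Lemma norm2_mult z w : norm2 (z * w)%C = norm2 z * norm2 w.
Proof. rewrite <- !norm2_Cmod, Cmod_mult; ring. Qed.

Lemma norm2_conj z : norm2 (Cconj z) = norm2 z.
Proof. now rewrite <- !norm2_Cmod, Cmod_conj. Qed.

Lemma norm2_div z w : w <> RtoC 0 -> norm2 (z / w)%C = norm2 z / norm2 w.
Proof.
intro H; rewrite <- !norm2_Cmod, Cmod_div by easy.
field; now apply Rgt_not_eq, Cmod_gt_0.
Qed.

Lemma norm2_pos z : z <> RtoC 0 <-> 0 < norm2 z.
Proof.
rewrite <- norm2_Cmod, Cmod_gt_0; pose proof (Cmod_ge_0 z); split; intro; nra.
Qed.

Lemma disk_norm2 z : disk z <-> norm2 z < 1.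
Proof.
unfold disk; rewrite <- norm2_Cmod; pose proof (Cmod_ge_0 z); split; intro; nra.
Qed.

Lemma disk_conj z : disk z -> disk (Cconj z).
Proof. unfold disk; now rewrite Cmod_conj. Qed.

Lemma disk_0 : disk (RtoC 0).
Proof. apply disk_norm2; unfold norm2; simpl; lra. Qed.

Lemma one_minus_norm2 z w :
  norm2 (1 - Cconj z * w)%C - norm2 (w - z)%C = (1 - norm2 z) * (1 - norm2 w).
Proof. destruct z, w; unfold norm2; simpl; ring. Qed.

Lemma one_minus_neq0 z w : disk z -> disk w -> (1 - Cconj z * w)%C <> RtoC 0.
Proof.
rewrite !disk_norm2, norm2_pos; intros Hz Hw.
pose proof (one_minus_norm2 z w).
assert (0 < (1 - norm2 z) * (1 - norm2 w)) by (apply Rmult_lt_0_compat; lra).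
assert (0 <= norm2 (w - z)%C) by (unfold norm2; nra); lra.
Qed.

Lemma mobius_norm2 p q z : in_SU11 p q ->
  norm2 (q * z + Cconj p)%C - norm2 (p * z + Cconj q)%C = 1 - norm2 z.
Proof.
unfold in_SU11; rewrite !norm2_Cmod; intro H.
replace (1 - norm2 z) with ((norm2 p - norm2 q) * (1 - norm2 z)) by (rewrite H; ring).
destruct p, q, z; unfold norm2; simpl; ring.
Qed.

Lemma mobius_den p q z : in_SU11 p q -> disk z -> (q * z + Cconj p)%C <> RtoC 0.
Proof.
intros H Hz; apply norm2_pos; apply disk_norm2 in Hz.
pose proof (mobius_norm2 p q z H).
assert (0 <= norm2 (p * z + Cconj q)%C) by (unfold norm2; nra); lra.
Qed.

Lemma mobius_one_minus p q z : in_SU11 p q -> disk z ->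
  1 - norm2 (mobius p q z) = (1 - norm2 z) / norm2 (q * z + Cconj p)%C.
Proof.
intros H Hz; pose proof (mobius_den p q z H Hz) as D.
unfold mobius; rewrite norm2_div by easy.
rewrite <- (mobius_norm2 p q z H); field.
apply norm2_pos in D; lra.
Qed.

Lemma disk_mobius p q z : in_SU11 p q -> disk z -> disk (mobius p q z).
Proof.
intros H Hz; pose proof (mobius_den p q z H Hz) as D.
pose proof (mobius_one_minus p q z H Hz) as E.
apply disk_norm2; apply disk_norm2 in Hz; apply norm2_pos in D.
assert (0 < (1 - norm2 z) / norm2 (q * z + Cconj p)%C)
  by (apply Rdiv_lt_0_compat; lra).
lra.
Qed.

Lemma mobius_comp p q p' q' z : in_SU11 p q -> in_SU11 p' q' -> disk z ->
  mobius p q (mobius p' q' z) = mobius (p * p' + Cconj q * q') (q * p' + Cconj p * q') z.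
Proof.
intros H H' Hz.
pose proof (mobius_den p' q' z H' Hz) as D'.
pose proof (mobius_den p q _ H (disk_mobius _ _ _ H' Hz)) as D.
assert (E : (q * mobius p' q' z + Cconj p)%C =
  (((q * p' + Cconj p * q') * z + Cconj (p * p' + Cconj q * q'))
    / (q' * z + Cconj p'))%C).
{ unfold mobius; rewrite Cplus_conj, !Cmult_conj, Cconj_conj; field; exact D'. }
unfold mobius at 1; rewrite E; rewrite E in D.
assert (D2 : ((q * p' + Cconj p * q') * z + Cconj (p * p' + Cconj q * q'))%C <> RtoC 0).
{ intro Z; apply D; rewrite Z; unfold Cdiv; apply Cmult_0_l. }
unfold mobius.
rewrite !Cplus_conj, !Cmult_conj, !Cconj_conj in *; field; auto.
Qed.

Lemma in_SU11_comp p q p' q' : in_SU11 p q -> in_SU11 p' q' ->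
  in_SU11 (p * p' + Cconj q * q') (q * p' + Cconj p * q').
Proof.
unfold in_SU11; rewrite !norm2_Cmod; intros H H'.
replace 1 with ((norm2 p - norm2 q) * (norm2 p' - norm2 q')) by (rewrite H, H'; ring).
destruct p, q, p', q'; unfold norm2; simpl; ring.
Qed.

Lemma mobius_conj p q z : in_SU11 p q -> disk z ->
  Cconj (mobius p q z) = mobius (Cconj p) (Cconj q) (Cconj z).
Proof.
intros H Hz; unfold mobius.
rewrite Cdiv_conj by now apply mobius_den.
now rewrite !Cplus_conj, !Cmult_conj.
Qed.

Lemma in_SU11_conj p q : in_SU11 p q -> in_SU11 (Cconj p) (Cconj q).
Proof. unfold in_SU11; now rewrite !Cmod_conj. Qed.

(** * The generators as anti-Moebius transformations *)

(* The direction of P1. *)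
Definition dir : C := (sn, mu / 2).

(* Every generator is [z |-> mobius (gen_p s) (gen_q s) (Cconj z)]. *)
Definition gen_p (s : gen) : C :=
  match s with
  | s1 => dir
  | s2 => (0, 1)
  | s3 => (- mu / (4 * sn), 1 / 2)
  end.
Definition gen_q (s : gen) : C :=
  match s with s3 => (0, dl / (2 * sn)) | _ => RtoC 0 end.

Lemma gen_SU11 s : in_SU11 (gen_p s) (gen_q s).
Proof.
unfold in_SU11; rewrite !norm2_Cmod; unfold norm2.
pose proof sn_pos; pose proof sn_sq as S.
unfold gen_p, gen_q, dir, RtoC; destruct s; cbn [Re Im fst snd]; [nra | ring |].
transitivity ((mu ^ 2 + 4 * sn ^ 2 - 4 * dl ^ 2) / (16 * sn ^ 2)); [field; repeat split; lra |].
rewrite dl_sq; replace (mu ^ 2) with (4 - 4 * sn ^ 2) by lra; field; lra.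
Qed.

Lemma to_origin_0 z : to_origin P0 z = z.
Proof.
unfold to_origin, P0; replace (Cconj (RtoC 0)) with (RtoC 0)
  by (unfold Cconj, RtoC; simpl; f_equal; ring).
field; intro H; injection H; lra.
Qed.

Lemma opp_P0 : (- P0)%C = P0.
Proof. unfold P0; ring. Qed.

Lemma reflection_0 Q e z : e <> RtoC 0 -> (exists r : R, r <> 0 /\ Q = (r * e)%C) ->
  reflection P0 Q z = (e * Cconj z / Cconj e)%C.
Proof.
intros He [r [Hr ->]]; unfold reflection; cbv zeta.
rewrite opp_P0, !to_origin_0, Cmult_conj.
replace (Cconj r) with (RtoC r) by (unfold Cconj, RtoC; simpl; f_equal; ring).
assert (RtoC r <> RtoC 0) by (intro H; injection H; easy).
assert (Cconj e <> RtoC 0).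
{ apply norm2_pos; rewrite norm2_conj; now apply norm2_pos. }
field; auto.
Qed.

Lemma P1_polar r : P1 r = (RtoC r * dir)%C.
Proof.
unfold P1, dir, sn, mu.
replace (5 * PI / 14) with (PI / 2 - PI / 7) by field.
rewrite cos_shift, sin_shift.
unfold RtoC, Cmult; simpl; f_equal; field.
Qed.

Lemma Cmult_cancel_r (c a b : C) : c <> RtoC 0 -> (a * c)%C = (b * c)%C -> a = b.
Proof.
intros Hc H; replace a with (a * c / c)%C by (field; exact Hc).
rewrite H; field; exact Hc.
Qed.

(* The geodesic P1 P2 is orthogonal to P0 P1 at P1. *)
Lemma direction_P1_P2 r y e : is_r0 r -> is_y0 y -> e = dir ->
  let u := to_origin (RtoC r * e) (P2 y) in (u / Cconj u)%C = (- (e * e))%C /\ u <> RtoC 0.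
Proof.
intros Hr Hy He u.
pose proof (r0_dl r Hr) as R; pose proof (y0_dl y Hy) as Y.
destruct Hr as [[Hr0 Hr1] _], Hy as [[Hy0 Hy1] _].
pose proof dl_pos; pose proof sn_pos; pose proof sn_sq as S; pose proof mu_bounds as [B0 B1].
assert (N : norm2 (RtoC r * e)%C = r ^ 2).
{ rewrite norm2_mult, He; unfold norm2, dir; simpl.
  replace (sn * (sn * 1)) with (1 - mu ^ 2 / 4) by lra; field. }
assert (D : (1 - Cconj (RtoC r * e) * P2 y)%C <> RtoC 0).
{ apply one_minus_neq0; apply disk_norm2; [rewrite N; nra |].
  unfold norm2, P2; simpl; nra. }
assert (X : (P2 y - RtoC r * e)%C <> RtoC 0).
{ intro Z; rewrite He in Z; unfold dir in Z; injection Z; intros _ Z'.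
  simpl in Z'; assert (0 < r * sn) by now apply Rmult_lt_0_compat.
  lra. }
assert (U : u <> RtoC 0).
{ unfold u, to_origin; intro Z; apply X.
  replace (P2 y - RtoC r * e)%C with
    ((P2 y - RtoC r * e) / (1 - Cconj (RtoC r * e) * P2 y) *
     (1 - Cconj (RtoC r * e) * P2 y))%C by (field; exact D).
  rewrite Z; ring. }
assert (U' : Cconj u <> RtoC 0).
{ apply norm2_pos; rewrite norm2_conj; now apply norm2_pos. }
split; [| exact U].
assert (K : mu * y * (1 + r ^ 2) = 2 * r * (1 + y ^ 2)).
{ apply Rmult_eq_reg_l with dl; [| lra].
  transitivity (mu * y * (dl * (1 + r ^ 2))); [ring |].
  rewrite R; rewrite <- Y; ring. }
assert (E : u = (- (e * e) * Cconj u)%C); [| rewrite E at 1; field; exact U'].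
assert (D' : (1 - (RtoC r * e) * Cconj (P2 y))%C <> RtoC 0).
{ intro Z; apply D.
  replace (1 - Cconj (RtoC r * e) * P2 y)%C
    with (Cconj (1 - (RtoC r * e) * Cconj (P2 y))%C).
  - rewrite Z; unfold Cconj, RtoC; simpl; f_equal; ring.
  - rewrite Cminus_conj, !Cmult_conj. rewrite (Cconj_conj (P2 y)); f_equal.
    unfold Cconj, RtoC; simpl; f_equal; ring. }
assert (Uc : Cconj u = ((Cconj (P2 y) - Cconj (RtoC r * e))
   / (1 - (RtoC r * e) * Cconj (P2 y)))%C).
{ unfold u, to_origin; rewrite Cdiv_conj by exact D.
  rewrite !Cminus_conj, (Cmult_conj (Cconj (RtoC r * e)) (P2 y)), (Cconj_conj (RtoC r * e)).
  f_equal; f_equal.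
  unfold Cconj, RtoC; simpl; f_equal; ring. }
rewrite Uc; unfold u, to_origin.
apply Cmult_cancel_r with
  ((1 - Cconj (RtoC r * e) * P2 y) * (1 - (RtoC r * e) * Cconj (P2 y)))%C.
1: { now apply Cmult_neq_0. }
transitivity ((P2 y - RtoC r * e) * (1 - (RtoC r * e) * Cconj (P2 y)))%C;
  [field; exact D |].
transitivity (- (e * e) * (Cconj (P2 y) - Cconj (RtoC r * e))
  * (1 - Cconj (RtoC r * e) * P2 y))%C; [| field; exact D'].
rewrite He; unfold P2, Cconj, RtoC, Cmult, Cminus, Cplus, Copp; simpl.
unfold dir; simpl.
assert (S2 : sn * sn + mu * mu / 4 - 1 = 0) by nra.
assert (K' : mu * y * (1 + r ^ 2) - 2 * r * (1 + y ^ 2) = 0) by lra.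
f_equal; apply Rminus_diag_uniq.
- transitivity (sn * (mu * y * (1 + r ^ 2) - 2 * r * (1 + y ^ 2))
    - (sn * sn + mu * mu / 4 - 1) * (r * sn * (1 + y ^ 2)));
    [field | rewrite K', S2; ring].
- transitivity (mu / 2 * (mu * y * (1 + r ^ 2) - 2 * r * (1 + y ^ 2))
    + (sn * sn + mu * mu / 4 - 1) * (y * (r ^ 2 * (sn * sn + mu * mu / 4 + 1) - 1 - r ^ 2)
       - r * (mu / 2) * (1 + y ^ 2)));
    [field | rewrite K', S2; ring].
Qed.

Lemma norm2_dir : norm2 dir = 1.
Proof. pose proof sn_sq; unfold norm2, dir; simpl; nra. Qed.

Lemma dir_conj : (dir * Cconj dir)%C = RtoC 1.
Proof. rewrite <- Cmod2_conj, norm2_Cmod, norm2_dir; reflexivity. Qed.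

Lemma dir_neq0 : dir <> RtoC 0.
Proof. apply norm2_pos; rewrite norm2_dir; lra. Qed.

Lemma dl_lt_1 : dl < 1.
Proof. pose proof dl_pos; pose proof dl_sq; pose proof mu_sq; nra. Qed.

Lemma Cconj_R (x : R) : Cconj (RtoC x) = RtoC x.
Proof. unfold Cconj, RtoC; simpl; f_equal; ring. Qed.

Lemma gen_act_s3 r y z : is_r0 r -> is_y0 y -> disk z ->
  gen_act r y s3 z = ((dir * Cconj z - RtoC dl) / (RtoC dl * Cconj z - Cconj dir))%C.
Proof.
intros Hr Hy Hz; unfold gen_act, reflection; cbv zeta.
rewrite P1_polar.
destruct (direction_P1_P2 r y dir Hr Hy eq_refl) as [-> _].
pose proof (r0_dl r Hr) as Rd; destruct Hr as [[Hr0 Hr1] _].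
pose proof dl_pos; pose proof dl_lt_1; pose proof dir_conj as DD; pose proof dir_neq0 as D0.
assert (Hp : disk (RtoC r * dir)%C).
{ apply disk_norm2; rewrite norm2_mult, norm2_dir; unfold norm2, RtoC; simpl; nra. }
assert (N1 : (1 - Cconj (RtoC r * dir) * z)%C <> RtoC 0) by now apply one_minus_neq0.
assert (N1' : (1 - RtoC r * dir * Cconj z)%C <> RtoC 0).
{ pose proof (one_minus_neq0 _ _ (disk_conj _ Hp) (disk_conj _ Hz)) as N.
  now rewrite Cconj_conj in N. }
assert (N2 : (1 - RtoC dl * dir * Cconj z)%C <> RtoC 0).
{ assert (Hd : disk (RtoC dl * dir)%C).
  { apply disk_norm2; rewrite norm2_mult, norm2_dir; unfold norm2, RtoC; simpl; nra. }
  pose proof (one_minus_neq0 _ _ (disk_conj _ Hd) (disk_conj _ Hz)) as N.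
  now rewrite Cconj_conj in N. }
unfold to_origin at 2; rewrite Cdiv_conj by exact N1.
rewrite !Cminus_conj, (Cmult_conj (Cconj _) z), (Cconj_conj (RtoC r * dir)), Cconj_R.
set (w := Cconj z) in *.
assert (Edl : (RtoC dl * (1 + RtoC r * RtoC r))%C = (2 * RtoC r)%C).
{ unfold RtoC, Cmult, Cplus; simpl; f_equal; [| ring].
  transitivity (dl * (1 + r ^ 2)); [ring | rewrite Rd; ring]. }
assert (N3 : (1 + RtoC r * RtoC r)%C <> RtoC 0).
{ rewrite <- RtoC_mult, <- RtoC_plus; intro Z; injection Z; nra. }
unfold to_origin; rewrite Copp_conj, !Cmult_conj, Cconj_R.
set (e' := Cconj dir) in *.
assert (E' : e' = (/ dir)%C).
{ apply Cmult_cancel_r with dir; [exact D0 |].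
  rewrite Cmult_comm, DD; field; exact D0. }
assert (Er : RtoC dl = (2 * RtoC r / (1 + RtoC r * RtoC r))%C).
{ rewrite <- Edl; field; exact N3. }
rewrite E'; rewrite Er in N2 |- *.
assert (N4 : ((1 + RtoC r * RtoC r) - 2 * RtoC r * dir * w)%C <> RtoC 0).
{ intro Z; apply N2.
  replace (1 - 2 * RtoC r / (1 + RtoC r * RtoC r) * dir * w)%C
    with (((1 + RtoC r * RtoC r) - 2 * RtoC r * dir * w) / (1 + RtoC r * RtoC r))%C
    by (field; exact N3).
  rewrite Z; unfold Cdiv; ring. }
field; repeat split; auto.
- intro Z; apply N4; replace ((1 + RtoC r * RtoC r) - 2 * RtoC r * dir * w)%C
    with (- (2 * RtoC r * w * dir - (1 + RtoC r * RtoC r)))%C by ring.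
  rewrite Z; ring.
- replace (dir * (dir * (1 - RtoC r * dir * w)) - - RtoC r * (- (dir * dir) * (w * dir - RtoC r)))%C
    with (dir * dir * ((1 + RtoC r * RtoC r) - 2 * RtoC r * dir * w))%C by ring.
  now repeat apply Cmult_neq_0.
Qed.

Lemma gen_act_mobius r y s z : is_r0 r -> is_y0 y -> disk z ->
  gen_act r y s z = mobius (gen_p s) (gen_q s) (Cconj z).
Proof.
intros Hr Hy Hz; pose proof sn_pos as Hs; pose proof dir_neq0 as D0.
pose proof (mobius_den _ _ _ (gen_SU11 s) (disk_conj _ Hz)) as N.
destruct s; unfold mobius.
- cbn [gen_act gen_p gen_q] in *; rewrite P1_polar, (reflection_0 _ dir); auto.
  + rewrite Cconj_R; f_equal; ring.
  + exists r; split; [destruct Hr; lra | reflexivity].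
- cbn [gen_act gen_p gen_q] in *; rewrite (reflection_0 _ (0, 1)).
  + rewrite Cconj_R; f_equal; ring.
  + intro Z; injection Z; lra.
  + exists y; split; [destruct Hy; lra |].
    unfold P2, RtoC, Cmult; simpl; f_equal; ring.
- rewrite gen_act_s3 by easy.
  (* The matrix read off [gen_act_s3] has |dir|^2 - dl^2 = 4 sn^2 and lower right entry - conj dir;
     the factor i / (2 sn) repairs both the determinant and the sign. *)
  set (k := ((0, 1 / (2 * sn)) : C)).
  assert (Hk : k <> RtoC 0).
  { intro Z; apply (f_equal snd) in Z; simpl in Z.
    assert (0 < 1 / (2 * sn)) by (apply Rdiv_lt_0_compat; lra); lra. }
  assert (Ep : gen_p s3 = (k * dir)%C).
  { unfold gen_p, k, dir, Cmult; simpl; f_equal; field; lra. }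
  assert (Eq : gen_q s3 = (k * RtoC dl)%C).
  { unfold gen_q, k, RtoC, Cmult; simpl; f_equal; field; lra. }
  assert (Ek : Cconj k = (- k)%C).
  { unfold k, Cconj, Copp; simpl; f_equal; ring. }
  rewrite Ep, Eq, !Cmult_conj, Ek, Cconj_R in *.
  assert (N' : (RtoC dl * Cconj z - Cconj dir)%C <> RtoC 0).
  { intro Z; apply N.
    replace (k * RtoC dl * Cconj z + - k * Cconj dir)%C
      with (k * (RtoC dl * Cconj z - Cconj dir))%C by ring.
    rewrite Z; ring. }
  field; split; auto.
Qed.

Lemma disk_gen_act r y s z : is_r0 r -> is_y0 y -> disk z -> disk (gen_act r y s z).
Proof.
intros Hr Hy Hz; rewrite gen_act_mobius by easy.
apply disk_mobius; [apply gen_SU11 | now apply disk_conj].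
Qed.

Lemma disk_act r y w z : is_r0 r -> is_y0 y -> disk z -> disk (act r y w z).
Proof.
intros Hr Hy Hz; induction w; simpl; [easy | now apply disk_gen_act].
Qed.

(** Letters are absorbed in pairs, as a single generator reverses orientation and is not a Moebius
    map. *)
Lemma even_represents r y w : is_r0 r -> is_y0 y ->
  Nat.even (length w) = true -> exists p q, represents r y p q w.
Proof.
intros Hr Hy; remember (length w) as n eqn:En; revert w En.
induction n as [n IH] using lt_wf_ind; intros [| s [| t w]] -> He; try discriminate.
- exists (RtoC 1), (RtoC 0); split.
  + unfold in_SU11; rewrite Cmod_1, Cmod_0; ring.
  + intros z _; unfold mobius; rewrite !Cconj_R; simpl; field.
- destruct (IH (length w) ltac:(simpl; lia) w eq_refl He) as [p [q [Hpq E]]].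
  pose proof (gen_SU11 s) as Ss; pose proof (in_SU11_conj _ _ (gen_SU11 t)) as St.
  eexists _, _; split; [exact (in_SU11_comp _ _ _ _ (in_SU11_comp _ _ _ _ Ss St) Hpq) |].
  intros z Hz; cbn [act].
  rewrite E, (gen_act_mobius r y t), (gen_act_mobius r y s); auto using disk_mobius, disk_gen_act.
  2: { apply disk_mobius; [apply gen_SU11 | now apply disk_conj, disk_mobius]. }
  rewrite mobius_conj; [| apply gen_SU11 | now apply disk_conj, disk_mobius].
  rewrite Cconj_conj, mobius_comp, mobius_comp; auto using disk_mobius, in_SU11_comp.
Qed.

(** * The Minkowski model *)

(* [lift z] is, up to a positive factor, the triple of products of the normals of
   the walls with the null or timelike vector (1 + |z|^2, 2 Re z, 2 Im z); the
   factor makes [lift 0] equal to [base]. *)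
Definition lift (z : C) : vec :=
  (2 * sn * (sn * (2 * Im z) - mu / 2 * (2 * Re z)) / dl,
   2 * sn * (2 * Re z) / dl,
   1 + norm2 z - (sn * (2 * Re z) + mu / 2 * (2 * Im z)) / dl).

Definition scale (k : R) (c : vec) : vec :=
  let '(c1, c2, c3) := c in (k * c1, k * c2, k * c3).

(** The normalisation puts z on the hyperboloid where the form equals 4 - mu^2. The unnormalised
    [lift] is kept because it also makes sense on the unit circle. *)
Definition point (z : C) : vec := scale (/ (1 - norm2 z)) (lift z).

Lemma form_minkowski t u v t' u' v' :
  form (2 * sn * (sn * v - mu / 2 * u) / dl, 2 * sn * u / dl, t - (sn * u + mu / 2 * v) / dl)
    (2 * sn * (sn * v' - mu / 2 * u') / dl, 2 * sn * u' / dl, t' - (sn * u' + mu / 2 * v') / dl)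
  = (4 - mu ^ 2) * (t * t' - u * u' - v * v').
Proof.
pose proof dl_pos; pose proof sn_sq as S; pose proof dl_sq as D.
assert (A : (/ dl) ^ 2 * (mu ^ 2 - 3) - 1 = 0) by (rewrite <- D; field; lra).
assert (N : sn ^ 2 + mu ^ 2 / 4 - 1 = 0) by lra.
unfold form, Rdiv; rewrite <- S; generalize dependent (/ dl); intros a A.
apply Rminus_diag_uniq.
transitivity ((sn ^ 2 + mu ^ 2 / 4 - 1) * (- 4 * sn * a * (t * u' + u * t')
   + a ^ 2 * (4 * sn ^ 2 * u * u' + 12 * sn ^ 2 * v * v' + 2 * mu * sn * (u * v' + v * u')))
  - 4 * sn ^ 2 * (u * u' + v * v') * (a ^ 2 * (mu ^ 2 - 3) - 1)).
- field.
- rewrite A, N; ring.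
Qed.

Lemma form_lift z w :
  form (lift z) (lift w) =
  (4 - mu ^ 2) * (2 * norm2 (1 - Cconj w * z)%C - (1 - norm2 z) * (1 - norm2 w)).
Proof.
unfold lift; rewrite form_minkowski; f_equal.
destruct z, w; unfold norm2; simpl; ring.
Qed.

Lemma form_scale_r k c d : form c (scale k d) = k * form c d.
Proof. destruct c as [[c1 c2] c3], d as [[d1 d2] d3]; simpl; ring. Qed.

Lemma refl_scale s k c : refl s (scale k c) = scale k (refl s c).
Proof. destruct s, c as [[c1 c2] c3]; simpl; vec_eq. Qed.

Lemma lift_0 : lift (RtoC 0) = base.
Proof.
unfold lift, norm2, RtoC, base; simpl; pose proof dl_pos; vec_eq; field; lra.
Qed.

Lemma point_0 : point (RtoC 0) = base.
Proof.
unfold point; rewrite lift_0; unfold norm2, base; simpl; vec_eq; field; lra.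
Qed.

Lemma scale_lift_div n d k : d <> RtoC 0 ->
  scale (norm2 d / k) (lift (n / d)) =
  let u := 2 * (Re n * Re d + Im n * Im d) in
  let v := 2 * (Im n * Re d - Re n * Im d) in
  scale (/ k)
  (2 * sn * (sn * v - mu / 2 * u) / dl, 2 * sn * u / dl,
   norm2 d + norm2 n - (sn * u + mu / 2 * v) / dl).
Proof.
intro Hd; apply norm2_pos in Hd; pose proof dl_pos as Hl.
assert (N : norm2 (n / d)%C = norm2 n / norm2 d).
{ apply norm2_div, norm2_pos; exact Hd. }
assert (Er : norm2 d * Re (n / d)%C = Re n * Re d + Im n * Im d).
{ destruct n as [n1 n2], d as [d1 d2]; unfold norm2, Cdiv, Cmult, Cinv in *; simpl in *.
  field; lra. }
assert (Ei : norm2 d * Im (n / d)%C = Im n * Re d - Re n * Im d).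
{ destruct n as [n1 n2], d as [d1 d2]; unfold norm2, Cdiv, Cmult, Cinv in *; simpl in *.
  field; lra. }
cbv zeta; rewrite <- Er, <- Ei; unfold lift; rewrite N.
set (X := Re (n / d)%C); set (Y := Im (n / d)%C); unfold scale, Rdiv.
generalize (/ k); intro k'; vec_eq; field; repeat split; lra.
Qed.

(** The Moebius denominator cancels against the change of 1 - norm2 z, so the action becomes linear;
    what remains are identities modulo the relations D and N between [sn], [mu] and [dl]. *)
Lemma point_gen_act r y s z : is_r0 r -> is_y0 y -> disk z ->
  point (gen_act r y s z) = refl s (point z).
Proof.
intros Hr Hy Hz; rewrite gen_act_mobius by easy.
pose proof (gen_SU11 s) as Hs; pose proof (disk_conj _ Hz) as Hz'.
pose proof (mobius_den _ _ _ Hs Hz') as Hd.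
unfold point; rewrite mobius_one_minus, norm2_conj by easy.
rewrite Rinv_div; unfold mobius; rewrite scale_lift_div by exact Hd.
rewrite refl_scale; cbv zeta; f_equal.
pose proof dl_pos as Hl; pose proof sn_pos as Hn; pose proof sn_sq as S.
assert (D : dl ^ 2 + 4 * sn ^ 2 - 1 = 0) by (rewrite dl_sn; ring).
assert (N : sn ^ 2 + mu ^ 2 / 4 - 1 = 0) by lra.
destruct z as [x y']; destruct s; unfold lift, norm2, gen_p, gen_q, dir, RtoC; simpl.
all: repeat match goal with |- (_, _) = (_, _) => apply f_equal2 end.
all: try (field; repeat split; lra).
all: apply Rminus_diag_uniq.
- transitivity ((sn ^ 2 + mu ^ 2 / 4 - 1) * (2 * sn * (mu * x - sn * (2 * y')) / dl));
    [field; repeat split; lra | rewrite N; ring].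
- transitivity ((sn ^ 2 + mu ^ 2 / 4 - 1) * (4 * sn * x / dl)); [field; repeat split; lra | rewrite N; ring].
- transitivity ((sn ^ 2 + mu ^ 2 / 4 - 1)
    * (1 + x ^ 2 + y' ^ 2 - (2 * sn * x + mu * y') / dl)); [field; repeat split; lra | rewrite N; ring].
- transitivity ((sn ^ 2 + mu ^ 2 / 4 - 1 - (dl ^ 2 + 4 * sn ^ 2 - 1))
    * ((2 * sn * y' - mu * x) / (2 * sn * dl))); [field; repeat split; lra | rewrite N, D; ring].
- transitivity ((sn ^ 2 + mu ^ 2 / 4 - 1 - (dl ^ 2 + 4 * sn ^ 2 - 1)) * (x / (sn * dl)));
    [field; repeat split; lra | rewrite N, D; ring].
- transitivity ((sn ^ 2 + mu ^ 2 / 4 - 1 - (dl ^ 2 + 4 * sn ^ 2 - 1))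
    * ((2 * sn * x + mu * y') / dl - (1 + x ^ 2 + y' ^ 2)) / (4 * sn ^ 2));
    [field; repeat split; lra | rewrite N, D; unfold Rdiv; ring].
Qed.

Lemma point_act r y w z : is_r0 r -> is_y0 y -> disk z -> point (act r y w z) = wact w (point z).
Proof.
intros Hr Hy Hz; induction w as [| s w IH]; simpl; [reflexivity |].
now rewrite point_gen_act, IH by auto using disk_act.
Qed.

(** Together with [point_act], this transfers the relations of Delta from the linear representation
    to the disk. *)
Lemma point_inj z w : disk z -> disk w -> point z = point w -> z = w.
Proof.
rewrite !disk_norm2; intros Hz Hw E.
pose proof dl_pos; pose proof sn_pos; pose proof mu_bounds.
unfold point, lift, scale in E.
set (k := / (1 - norm2 z)) in *; set (l := / (1 - norm2 w)) in *.
assert (Kz : k * (1 - norm2 z) = 1) by (unfold k; field; lra).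
assert (Lw : l * (1 - norm2 w) = 1) by (unfold l; field; lra).
assert (Hk : 0 < k) by (apply Rinv_0_lt_compat; lra).
injection E as E1 E2 E3.
assert (X : k * Re z = l * Re w).
{ apply Rmult_eq_reg_l with (2 * sn * 2 / dl); [| apply Rgt_not_eq, Rdiv_lt_0_compat; lra].
  transitivity (k * (2 * sn * (2 * Re z) / dl)); [unfold Rdiv; ring |].
  rewrite E2; unfold Rdiv; ring. }
assert (Y : k * Im z = l * Im w).
{ apply Rmult_eq_reg_l with (2 * sn * (sn * 2) / dl);
    [| apply Rgt_not_eq, Rdiv_lt_0_compat; nra].
  transitivity (k * (2 * sn * (sn * (2 * Im z) - mu / 2 * (2 * Re z)) / dl)
    + 2 * sn * mu / dl * (k * Re z)); [unfold Rdiv; field; repeat split; lra |].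
  rewrite E1, X; unfold Rdiv; field; lra. }
assert (T : k * (1 + norm2 z) = l * (1 + norm2 w)).
{ transitivity (k * (1 + norm2 z - (sn * (2 * Re z) + mu / 2 * (2 * Im z)) / dl)
    + (sn * 2 * (k * Re z) + mu / 2 * 2 * (k * Im z)) / dl); [unfold Rdiv; ring |].
  rewrite E3, X, Y; unfold Rdiv; ring. }
assert (KL : k = l) by lra.
rewrite <- KL in X, Y; apply Rmult_eq_reg_l in X; [| lra]; apply Rmult_eq_reg_l in Y; [| lra].
destruct z, w; simpl in *; congruence.
Qed.

(** * The distance formula *)

Lemma cont_plus (f g : R -> R) t :
  continuous f t -> continuous g t -> continuous (fun s => f s + g s) t.
Proof. exact (@continuous_plus _ R_AbsRing R_NormedModule f g t). Qed.

Lemma cont_opp (f : R -> R) t : continuous f t -> continuous (fun s => - f s) t.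
Proof. exact (@continuous_opp _ R_AbsRing R_NormedModule f t). Qed.

Lemma cont_minus (f g : R -> R) t :
  continuous f t -> continuous g t -> continuous (fun s => f s - g s) t.
Proof. exact (@continuous_minus _ R_AbsRing R_NormedModule f g t). Qed.

Lemma cont_mult (f g : R -> R) t :
  continuous f t -> continuous g t -> continuous (fun s => f s * g s) t.
Proof. exact (@continuous_mult _ R_AbsRing f g t). Qed.

Lemma cont_pow2 (f : R -> R) t : continuous f t -> continuous (fun s => f s ^ 2) t.
Proof.
intro H; apply cont_mult; [easy | apply cont_mult; [easy | apply continuous_const]].
Qed.

Lemma cont_div (f g : R -> R) t :
  continuous f t -> continuous g t -> g t <> 0 -> continuous (fun s => f s / g s) t.
Proof.
intros Hf Hg H; apply cont_mult; [exact Hf |].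
apply continuity_pt_filterlim, continuity_pt_inv; [now apply continuity_pt_filterlim | easy].
Qed.

Lemma cont_sqrt (f : R -> R) t : continuous f t -> 0 <= f t -> continuous (fun s => sqrt (f s)) t.
Proof.
intros Hf H; apply (continuous_comp f sqrt); [exact Hf |].
now apply continuity_pt_filterlim, continuity_pt_sqrt.
Qed.

Ltac cont := repeat match goal with
  | |- continuous (fun _ => ?c) _ => apply continuous_const
  | |- continuous (fun _ => _ + _) _ => apply cont_plus
  | |- continuous (fun _ => _ - _) _ => apply cont_minus
  | |- continuous (fun _ => - _) _ => apply cont_opp
  | |- continuous (fun _ => _ ^ 2) _ => apply cont_pow2
  | |- continuous (fun _ => _ * _) _ => apply cont_mult
  | |- continuous (fun _ => _ / _) _ => apply cont_div
  | |- continuous (fun _ => sqrt _) _ => apply cont_sqrt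
  | |- continuous (Rmult ?r) _ => apply (cont_mult (fun _ => r) (fun s => s))
  | |- continuous (fun s => s) _ => apply continuous_id
  | |- continuous _ _ => assumption
  end.

Lemma sum_squares_pos a b x y :
  a ^ 2 + b ^ 2 = 1 -> x ^ 2 + y ^ 2 < 1 -> 0 < (a - x) ^ 2 + (b - y) ^ 2.
Proof.
intros Hab Hxy.
pose proof (pow2_ge_0 (a - x)); pose proof (pow2_ge_0 (b - y)).
destruct (Req_dec (a - x) 0) as [Ea | Ea]; [| pose proof (pow2_gt_0 _ Ea); lra].
destruct (Req_dec (b - y) 0) as [Eb | Eb]; [| pose proof (pow2_gt_0 _ Eb); lra].
apply Rminus_diag_uniq in Ea, Eb; subst; lra.
Qed.

Lemma le_mult_sqrt u c s : 0 <= c -> 0 <= s -> u ^ 2 <= c ^ 2 * s -> u <= c * sqrt s.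
Proof.
intros Hc Hs H; destruct (Rle_dec u 0) as [L | L].
- apply Rle_trans with 0; [easy |]; apply Rmult_le_pos; [easy | apply sqrt_pos].
- apply Rsqr_incr_0_var; [| apply Rmult_le_pos; [easy | apply sqrt_pos]].
  rewrite Rsqr_mult, Rsqr_sqrt, !Rsqr_pow2 by easy; exact H.
Qed.

(* The gradient of [ln ((1 - x^2 - y^2) / ((a - x)^2 + (b - y)^2))] has norm
   2 / (1 - x^2 - y^2): this Busemann function is 1-Lipschitz. *)
Lemma busemann_gradient a b x y x' y' :
  a ^ 2 + b ^ 2 = 1 -> x ^ 2 + y ^ 2 < 1 ->
  - (2 * x * x' + 2 * y * y') / (1 - x ^ 2 - y ^ 2)
  + (2 * (a - x) * x' + 2 * (b - y) * y') / ((a - x) ^ 2 + (b - y) ^ 2)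
  <= 2 * sqrt (x' ^ 2 + y' ^ 2) / (1 - x ^ 2 - y ^ 2).
Proof.
intros Hab Hxy.
set (m := 1 - x ^ 2 - y ^ 2); set (n := (a - x) ^ 2 + (b - y) ^ 2).
assert (Hm : 0 < m) by (unfold m; lra).
assert (Hn : 0 < n).
{ now apply sum_squares_pos. }
set (g1 := - 2 * x / m + 2 * (a - x) / n); set (g2 := - 2 * y / m + 2 * (b - y) / n).
assert (G : g1 ^ 2 + g2 ^ 2 = (2 / m) ^ 2).
{ transitivity (4 * ((x ^ 2 + y ^ 2) / m ^ 2 - 2 * (x * (a - x) + y * (b - y)) / (m * n)
    + ((a - x) ^ 2 + (b - y) ^ 2) / n ^ 2)); [unfold g1, g2; field; lra |].
  replace (2 * (x * (a - x) + y * (b - y))) with (m - n) by (unfold m, n; lra).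
  replace (x ^ 2 + y ^ 2) with (1 - m) by (unfold m; ring).
  fold n; field; lra. }
replace (- (2 * x * x' + 2 * y * y') / m + (2 * (a - x) * x' + 2 * (b - y) * y') / n)
  with (g1 * x' + g2 * y') by (unfold g1, g2; field; lra).
replace (2 * sqrt (x' ^ 2 + y' ^ 2) / m) with (2 / m * sqrt (x' ^ 2 + y' ^ 2)) by (field; lra).
apply le_mult_sqrt; [apply Rlt_le, Rdiv_lt_0_compat; lra | nra |].
(* Cauchy-Schwarz, by Lagrange's identity. *)
rewrite <- G; assert (0 <= (g1 * y' - g2 * x') ^ 2) by apply pow2_ge_0; nra.
Qed.

Definition busemann (xi z : C) : R := ln (1 - norm2 z) - ln (norm2 (xi - z)%C).

(** The gradient bound integrated along the path. It is sharp when xi is the ideal end of the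
    geodesic from z through w. *)
Lemma path_length_busemann f z w xi :
  C1_path f z w -> norm2 xi = 1 -> busemann xi w - busemann xi z <= path_length f.
Proof.
intros [F0 [F1 F]] Hxi; destruct xi as [a b]; unfold norm2 in Hxi; simpl Re in Hxi; simpl Im in Hxi.
set (x := fun s => Re (f s)); set (y := fun s => Im (f s)).
assert (Hd : forall t, 0 <= t <= 1 -> x t ^ 2 + y t ^ 2 < 1).
{ intros t Ht; destruct (F t Ht) as [D _]; now apply disk_norm2 in D. }
assert (Hn : forall t, 0 <= t <= 1 -> 0 < (a - x t) ^ 2 + (b - y t) ^ 2).
{ intros t Ht; apply sum_squares_pos; auto. }
set (B := fun t => ln (1 - x t ^ 2 - y t ^ 2) - ln ((a - x t) ^ 2 + (b - y t) ^ 2)).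
set (dB := fun t => - (2 * x t * Derive x t + 2 * y t * Derive y t) / (1 - x t ^ 2 - y t ^ 2)
  + (2 * (a - x t) * Derive x t + 2 * (b - y t) * Derive y t)
    / ((a - x t) ^ 2 + (b - y t) ^ 2)).
set (L := fun t => 2 * sqrt (Derive x t ^ 2 + Derive y t ^ 2) / (1 - x t ^ 2 - y t ^ 2)).
assert (C : forall t, 0 <= t <= 1 -> continuous x t /\ continuous y t /\
  continuous (Derive x) t /\ continuous (Derive y) t).
{ intros t Ht; destruct (F t Ht) as (_ & Dx & Cx & Dy & Cy); repeat split; auto.
  - now apply (ex_derive_continuous (V := R_NormedModule)).
  - now apply (ex_derive_continuous (V := R_NormedModule)). }
assert (IB : is_RInt dB 0 1 (B 1 - B 0)).
{ apply (is_RInt_derive (V := R_CompleteNormedModule) B dB);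
    rewrite Rmin_left, Rmax_right by lra; intros t Ht;
    specialize (Hd t Ht); specialize (Hn t Ht).
  - destruct (F t Ht) as (_ & Dx & _ & Dy & _).
    unfold B, dB; auto_derive; [repeat split; auto; lra |].
    fold x; fold y; change (fun s => x s) with x; change (fun s => y s) with y; field; lra.
  - destruct (C t Ht) as (Cx & Cy & Cx' & Cy').
    unfold dB; cont; lra. }
assert (IL : ex_RInt L 0 1).
{ apply (ex_RInt_continuous (V := R_CompleteNormedModule)).
  rewrite Rmin_left, Rmax_right by lra; intros t Ht; specialize (Hd t Ht).
  destruct (C t Ht) as (Cx & Cy & Cx' & Cy'); unfold L; cont; [| lra].
  assert (0 <= Derive x t ^ 2) by apply pow2_ge_0.
  assert (0 <= Derive y t ^ 2) by apply pow2_ge_0; lra. }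
replace (busemann (a, b) w - busemann (a, b) z) with (B 1 - B 0).
- rewrite <- (is_RInt_unique _ _ _ _ IB); apply RInt_le; [lra | now exists (B 1 - B 0) | exact IL |].
  intros t Ht; apply busemann_gradient; [exact Hxi | apply Hd; lra].
- unfold B, x, y; rewrite F0, F1; unfold busemann, norm2.
  destruct z as [z1 z2], w as [w1 w2]; simpl.
  f_equal; f_equal; f_equal; ring.
Qed.

(** The radius in direction sg, carried by the isometry that takes 0 to z; s = 1 gives the ideal
    end. *)
Definition geodesic (z sg : C) (s : R) : C := ((RtoC s * sg + z) / (1 + Cconj z * (RtoC s * sg)))%C.

Lemma norm2_real_mult s z : norm2 (RtoC s * z)%C = s ^ 2 * norm2 z.
Proof. rewrite norm2_mult; unfold norm2, RtoC; simpl; ring. Qed.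

Lemma geodesic_den_pos z sg s : disk z -> norm2 sg = 1 -> s ^ 2 <= 1 ->
  0 < norm2 (1 + Cconj z * (RtoC s * sg))%C.
Proof.
intros Hz Hs H; apply norm2_pos; intro Z; apply disk_norm2 in Hz.
assert (E : norm2 (Cconj z * (RtoC s * sg))%C = 1).
{ replace (Cconj z * (RtoC s * sg))%C with (-(1))%C.
  - unfold norm2; simpl; ring.
  - replace (Cconj z * (RtoC s * sg))%C with ((1 + Cconj z * (RtoC s * sg)) - 1)%C by ring.
    rewrite Z; ring. }
rewrite norm2_mult, norm2_real_mult, norm2_conj, Hs in E.
assert (0 <= norm2 z) by (unfold norm2; nra); nra.
Qed.

Lemma geodesic_one_minus z sg s : disk z -> norm2 sg = 1 -> s ^ 2 <= 1 ->
  1 - norm2 (geodesic z sg s) =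
  (1 - norm2 z) * (1 - s ^ 2) / norm2 (1 + Cconj z * (RtoC s * sg))%C.
Proof.
intros Hz Hs H; pose proof (geodesic_den_pos z sg s Hz Hs H) as P.
unfold geodesic; rewrite norm2_div by now apply norm2_pos.
assert (E : norm2 (1 + Cconj z * (RtoC s * sg))%C - norm2 (RtoC s * sg + z)%C =
  (1 - norm2 z) * (1 - s ^ 2)).
{ replace (1 - s ^ 2) with (1 - s ^ 2 * norm2 sg) by (rewrite Hs; ring).
  destruct z, sg; unfold norm2, RtoC; simpl; ring. }
rewrite <- E; field; lra.
Qed.

Lemma disk_geodesic z sg s : disk z -> norm2 sg = 1 -> s ^ 2 < 1 -> disk (geodesic z sg s).
Proof.
intros Hz Hs H; pose proof (geodesic_den_pos z sg s Hz Hs ltac:(lra)) as P.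
pose proof (geodesic_one_minus z sg s Hz Hs ltac:(lra)) as E.
apply disk_norm2; apply disk_norm2 in Hz.
assert (0 < (1 - norm2 z) * (1 - s ^ 2) / norm2 (1 + Cconj z * (RtoC s * sg))%C).
{ apply Rdiv_lt_0_compat; [apply Rmult_lt_0_compat; lra | exact P]. }
lra.
Qed.

Lemma norm2_geodesic_end z sg : disk z -> norm2 sg = 1 -> norm2 (geodesic z sg 1) = 1.
Proof.
intros Hz Hs; pose proof (geodesic_one_minus z sg 1 Hz Hs ltac:(lra)) as E.
pose proof (geodesic_den_pos z sg 1 Hz Hs ltac:(lra)).
replace ((1 - norm2 z) * (1 - 1 ^ 2) / norm2 (1 + Cconj z * (RtoC 1 * sg))%C)
  with 0 in E by (field; lra); lra.
Qed.

Lemma busemann_geodesic z sg s : disk z -> norm2 sg = 1 -> 0 <= s < 1 ->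
  busemann (geodesic z sg 1) (geodesic z sg s) - busemann (geodesic z sg 1) z =
  ln ((1 + s) / (1 - s)).
Proof.
intros Hz Hs H.
pose proof (geodesic_den_pos z sg 1 Hz Hs ltac:(lra)) as P1.
assert (K : forall t, 0 <= t < 1 -> 
  busemann (geodesic z sg 1) (geodesic z sg t) =
  ln ((1 + t) / (1 - t)) + ln (norm2 (1 + Cconj z * (RtoC 1 * sg))%C / (1 - norm2 z))).
{ intros t Ht.
  assert (Ht2 : t ^ 2 < 1) by nra.
  pose proof (geodesic_den_pos z sg t Hz Hs ltac:(lra)) as P.
  unfold busemann; rewrite geodesic_one_minus by (auto; lra).
  apply disk_norm2 in Hz.
  assert (D : norm2 (geodesic z sg 1 - geodesic z sg t)%C =
    (1 - t) ^ 2 * (1 - norm2 z) ^ 2 / (norm2 (1 + Cconj z * (RtoC 1 * sg))%C *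
      norm2 (1 + Cconj z * (RtoC t * sg))%C)).
  { assert (N1 := proj2 (norm2_pos _) P1); assert (Nt := proj2 (norm2_pos _) P).
    replace (geodesic z sg 1 - geodesic z sg t)%C with
      (RtoC (1 - t) * (RtoC (1 - norm2 z) * sg) /
       ((1 + Cconj z * (RtoC 1 * sg)) * (1 + Cconj z * (RtoC t * sg))))%C.
    - rewrite norm2_div by now apply Cmult_neq_0.
      rewrite !norm2_real_mult, Hs, norm2_mult; field; lra.
    - assert (Nz : RtoC (norm2 z) = (z * Cconj z)%C).
      { now rewrite <- Cmod2_conj, norm2_Cmod. }
      rewrite !RtoC_minus, Nz; unfold geodesic; field; rewrite Cmult_1_l in N1; now split. }
  rewrite D, <- ln_div, <- ln_mult.
  - f_equal; field; repeat split; lra.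
  - apply Rdiv_lt_0_compat; lra.
  - apply Rdiv_lt_0_compat; lra.
  - apply Rdiv_lt_0_compat; [apply Rmult_lt_0_compat; lra | exact P].
  - apply Rdiv_lt_0_compat; [| now apply Rmult_lt_0_compat].
    apply Rmult_lt_0_compat; apply pow_lt; lra. }
assert (G0 : geodesic z sg 0 = z).
{ unfold geodesic; field. }
rewrite <- G0 at 4; rewrite !K by (auto; lra).
replace ((1 + 0) / (1 - 0)) with 1 by field; rewrite ln_1; ring.
Qed.

Lemma geodesic_coords z1 z2 c e s :
  let p := 1 + s * (z1 * c + z2 * e) in let q := s * (z1 * e - z2 * c) in
  geodesic (z1, z2) (c, e) s =
  (((s * c + z1) * p + (s * e + z2) * q) / (p ^ 2 + q ^ 2),
   ((s * e + z2) * p - (s * c + z1) * q) / (p ^ 2 + q ^ 2)).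
Proof.
intros p q; unfold geodesic.
replace (RtoC s * (c, e) + (z1, z2))%C with ((s * c + z1, s * e + z2) : C)
  by (unfold RtoC, Cmult, Cplus; simpl; f_equal; ring).
replace (1 + Cconj (z1, z2) * (RtoC s * (c, e)))%C with ((p, q) : C)
  by (unfold p, q, RtoC, Cconj, Cmult, Cplus; simpl; f_equal; ring).
unfold Cdiv, Cinv, Cmult; simpl; f_equal; unfold Rdiv; ring.
Qed.

Lemma geodesic_den z1 z2 c e s :
  norm2 (1 + Cconj (z1, z2) * (RtoC s * (c, e)))%C =
  (1 + s * (z1 * c + z2 * e)) ^ 2 + (s * (z1 * e - z2 * c)) ^ 2.
Proof. unfold norm2, RtoC; simpl; ring. Qed.

Definition geodesic_dre (z sg : C) (s : R) : R :=
  let '(z1, z2) := z in let '(c, e) := sg in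
  let p := 1 + s * (z1 * c + z2 * e) in let q := s * (z1 * e - z2 * c) in
  (1 - z1 ^ 2 - z2 ^ 2) * (c * (p ^ 2 - q ^ 2) + 2 * e * p * q) / (p ^ 2 + q ^ 2) ^ 2.

Definition geodesic_dim (z sg : C) (s : R) : R :=
  let '(z1, z2) := z in let '(c, e) := sg in
  let p := 1 + s * (z1 * c + z2 * e) in let q := s * (z1 * e - z2 * c) in
  (1 - z1 ^ 2 - z2 ^ 2) * (e * (p ^ 2 - q ^ 2) - 2 * c * p * q) / (p ^ 2 + q ^ 2) ^ 2.

Lemma geodesic_derive z sg r t : disk z -> norm2 sg = 1 -> (r * t) ^ 2 <= 1 ->
  is_derive (fun t => Re (geodesic z sg (r * t))) t (r * geodesic_dre z sg (r * t)) /\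
  is_derive (fun t => Im (geodesic z sg (r * t))) t (r * geodesic_dim z sg (r * t)).
Proof.
intros Hz Hs H; pose proof (geodesic_den_pos z sg _ Hz Hs H) as P.
destruct z as [z1 z2], sg as [c e]; rewrite geodesic_den in P.
split.
- apply (is_derive_ext (fun t =>
    ((r * t * c + z1) * (1 + r * t * (z1 * c + z2 * e))
      + (r * t * e + z2) * (r * t * (z1 * e - z2 * c)))
    / ((1 + r * t * (z1 * c + z2 * e)) ^ 2 + (r * t * (z1 * e - z2 * c)) ^ 2))).
  { intro u; now rewrite geodesic_coords. }
  unfold geodesic_dre; auto_derive; [lra | field; lra].
- apply (is_derive_ext (fun t =>
    ((r * t * e + z2) * (1 + r * t * (z1 * c + z2 * e))
      - (r * t * c + z1) * (r * t * (z1 * e - z2 * c)))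
    / ((1 + r * t * (z1 * c + z2 * e)) ^ 2 + (r * t * (z1 * e - z2 * c)) ^ 2))).
  { intro u; now rewrite geodesic_coords. }
  unfold geodesic_dim; auto_derive; [lra | field; lra].
Qed.

Lemma geodesic_derive_continuous z sg r t : disk z -> norm2 sg = 1 -> (r * t) ^ 2 <= 1 ->
  continuous (fun t => r * geodesic_dre z sg (r * t)) t /\
  continuous (fun t => r * geodesic_dim z sg (r * t)) t.
Proof.
intros Hz Hs H; pose proof (geodesic_den_pos z sg _ Hz Hs H) as P.
destruct z as [z1 z2], sg as [c e]; rewrite geodesic_den in P.
split; cbv beta iota zeta delta [geodesic_dre geodesic_dim]; cont; apply pow_nonzero; lra.
Qed.

Lemma geodesic_speed z sg s : disk z -> norm2 sg = 1 -> s ^ 2 <= 1 ->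
  geodesic_dre z sg s ^ 2 + geodesic_dim z sg s ^ 2 =
  ((1 - norm2 z) / norm2 (1 + Cconj z * (RtoC s * sg))%C) ^ 2.
Proof.
intros Hz Hs H; pose proof (geodesic_den_pos z sg _ Hz Hs H) as P.
destruct z as [z1 z2], sg as [c e]; rewrite geodesic_den in *.
unfold geodesic_dre, geodesic_dim; set (p := 1 + _) in *; set (q := s * (z1 * e - _)) in *.
transitivity ((c ^ 2 + e ^ 2) * ((1 - norm2 (z1, z2)) / (p ^ 2 + q ^ 2)) ^ 2).
- unfold norm2; simpl Re; simpl Im; field; lra.
- unfold norm2 in Hs; simpl Re in Hs; simpl Im in Hs; rewrite Hs; ring.
Qed.

Lemma geodesic_path z sg r : disk z -> norm2 sg = 1 -> 0 <= r < 1 ->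
  let f t := geodesic z sg (r * t) in
  C1_path f z (geodesic z sg r) /\ path_length f = ln ((1 + r) / (1 - r)).
Proof.
intros Hz Hs Hr f.
(* Continuity of [Derive] at the ends 0 and 1 requires the formula on a full neighbourhood; r < 1
   leaves the margin 1 - r. *)
assert (D : forall t, 0 <= t <= 1 -> locally t (fun u => (r * u) ^ 2 <= 1)).
{ intros t Ht; exists (mkposreal (1 - r) ltac:(lra)); intros u Hu.
  unfold ball in Hu; simpl in Hu; unfold AbsRing_ball, abs, minus, plus, opp in Hu; simpl in Hu.
  apply Rabs_def2 in Hu as [Hu1 Hu2].
  assert (0 <= r * (t - (r - 1) - u)) by (apply Rmult_le_pos; lra).
  assert (0 <= r * (u - t + (1 - r))) by (apply Rmult_le_pos; lra).
  assert (r * u <= 1) by nra; assert (-1 <= r * u) by nra; nra. }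
assert (D' : forall t, 0 <= t <= 1 -> (r * t) ^ 2 < 1).
{ intros t Ht; assert (0 <= r * t <= r) by nra; nra. }
assert (Dr : forall t, 0 <= t <= 1 ->
  locally t (fun u => Derive (fun s => Re (f s)) u = r * geodesic_dre z sg (r * u))).
{ intros t Ht; apply (filter_imp _ _) with (2 := D t Ht); intros u Hu.
  now apply is_derive_unique, geodesic_derive. }
assert (Di : forall t, 0 <= t <= 1 ->
  locally t (fun u => Derive (fun s => Im (f s)) u = r * geodesic_dim z sg (r * u))).
{ intros t Ht; apply (filter_imp _ _) with (2 := D t Ht); intros u Hu.
  now apply is_derive_unique, geodesic_derive. }
split; [split; [| split] |].
- unfold f; rewrite Rmult_0_r; unfold geodesic; field.
- unfold f; now rewrite Rmult_1_r.
- intros t Ht; pose proof (D' t Ht) as L.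
  destruct (geodesic_derive z sg r t Hz Hs ltac:(lra)) as [E1 E2].
  destruct (geodesic_derive_continuous z sg r t Hz Hs ltac:(lra)) as [C1 C2].
  split; [now apply disk_geodesic |].
  split; [eexists; exact E1 |]; split; [| split; [eexists; exact E2 |]].
  + eapply continuous_ext_loc; [| exact C1].
    apply (filter_imp _ _) with (2 := Dr t Ht); intros u Hu; now symmetry.
  + eapply continuous_ext_loc; [| exact C2].
    apply (filter_imp _ _) with (2 := Di t Ht); intros u Hu; now symmetry.
- assert (I : is_RInt (fun t => 2 * r / (1 - (r * t) ^ 2)) 0 1
    (ln ((1 + r * 1) / (1 - r * 1)) - ln ((1 + r * 0) / (1 - r * 0)))).
  { apply (is_RInt_derive (V := R_CompleteNormedModule)
      (fun t => ln ((1 + r * t) / (1 - r * t))));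
      rewrite Rmin_left, Rmax_right by lra; intros t Ht; pose proof (D' t Ht);
      assert (0 <= r * t <= r) by nra.
    - auto_derive.
      + repeat split; try lra; apply Rdiv_lt_0_compat; lra.
      + field; repeat split; lra.
    -       cont; lra. }
  replace (ln ((1 + r) / (1 - r)))
    with (ln ((1 + r * 1) / (1 - r * 1)) - ln ((1 + r * 0) / (1 - r * 0))).
  2: { rewrite Rmult_0_r, Rmult_1_r; replace ((1 + 0) / (1 - 0)) with 1 by field.
       rewrite ln_1; ring. }
  apply is_RInt_unique; eapply is_RInt_ext; [| exact I].
  rewrite Rmin_left, Rmax_right by lra; intros t Ht; cbv beta.
  match goal with |- ?x = ?y => change (@eq R x y) end.
  rewrite (locally_singleton _ _ (Dr t ltac:(lra))), (locally_singleton _ _ (Di t ltac:(lra))).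
  pose proof (D' t ltac:(lra)) as L.
  pose proof (geodesic_den_pos z sg (r * t) Hz Hs ltac:(lra)) as P.
  pose proof (geodesic_one_minus z sg (r * t) Hz Hs ltac:(lra)) as M.
  pose proof (geodesic_speed z sg (r * t) Hz Hs ltac:(lra)) as S.
  apply disk_norm2 in Hz.
  replace (1 - Re (f t) ^ 2 - Im (f t) ^ 2) with (1 - norm2 (geodesic z sg (r * t)))
    by (unfold f, norm2; ring).
  rewrite M.
  replace ((r * geodesic_dre z sg (r * t)) ^ 2 + (r * geodesic_dim z sg (r * t)) ^ 2)
    with ((r * ((1 - norm2 z) / norm2 (1 + Cconj z * (RtoC (r * t) * sg))%C)) ^ 2)
    by (rewrite Rpow_mult_distr, <- S; ring).
  rewrite sqrt_pow2; [field; repeat split; lra |].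
  apply Rmult_le_pos; [lra |]; apply Rlt_le, Rdiv_lt_0_compat; lra.
Qed.

Lemma Cmod_polar a : exists sg, norm2 sg = 1 /\ a = (RtoC (Cmod a) * sg)%C.
Proof.
destruct (classic (a = RtoC 0)) as [-> | H].
- exists (RtoC 1); split; [unfold norm2, RtoC; simpl; ring | rewrite Cmod_0; ring].
- assert (M : RtoC (Cmod a) <> RtoC 0).
  { intro Z; apply H, Cmod_eq_0; now injection Z. }
  exists (a / RtoC (Cmod a))%C; split; [| field; exact M].
  rewrite norm2_div by exact M; apply norm2_pos in H; unfold norm2 at 2, RtoC; simpl Re; simpl Im.
  rewrite <- norm2_Cmod in *; field; nra.
Qed.

Lemma to_origin_norm2 z w : disk z -> disk w ->
  1 - norm2 (to_origin z w) = (1 - norm2 z) * (1 - norm2 w) / norm2 (1 - Cconj z * w)%C.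
Proof.
intros Hz Hw; pose proof (one_minus_neq0 z w Hz Hw) as N.
unfold to_origin; rewrite norm2_div by exact N.
rewrite <- one_minus_norm2; apply norm2_pos in N; field; lra.
Qed.

Lemma disk_to_origin z w : disk z -> disk w -> disk (to_origin z w).
Proof.
intros Hz Hw; pose proof (to_origin_norm2 z w Hz Hw) as E.
pose proof (one_minus_neq0 z w Hz Hw) as N; apply norm2_pos in N.
rewrite !disk_norm2 in *.
assert (0 < (1 - norm2 z) * (1 - norm2 w) / norm2 (1 - Cconj z * w)%C); [| lra].
apply Rdiv_lt_0_compat; [apply Rmult_lt_0_compat; lra | exact N].
Qed.

Lemma hyp_dist_formula z w : disk z -> disk w ->
  hyp_dist z w = ln ((1 + Cmod (to_origin z w)) / (1 - Cmod (to_origin z w))).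
Proof.
intros Hz Hw; pose proof (disk_to_origin z w Hz Hw) as Ha.
pose proof (one_minus_neq0 z w Hz Hw) as N.
set (a := to_origin z w) in *; destruct (Cmod_polar a) as [sg [Hs Ea]].
set (r := Cmod a) in *; assert (Hr : 0 <= r < 1) by (split; [apply Cmod_ge_0 | exact Ha]).
assert (Ew : geodesic z sg r = w).
{ pose proof (geodesic_den_pos z sg r Hz Hs ltac:(nra)) as P.
  unfold geodesic in *; rewrite <- Ea in *; apply norm2_pos in P.
  assert (Nz : (1 - z * Cconj z)%C <> RtoC 0).
  { rewrite <- Cmod2_conj, norm2_Cmod, <- RtoC_minus; apply disk_norm2 in Hz.
    intro Z; injection Z; lra. }
  unfold a, to_origin in *; field; split; [exact N |].
  intro Z; apply Nz; rewrite <- Z; ring. }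
destruct (geodesic_path z sg r Hz Hs Hr) as [Pf Lf]; rewrite Ew in Pf.
assert (G : is_glb_Rbar (fun L => exists f, C1_path f z w /\ L = path_length f)
  (ln ((1 + r) / (1 - r)))).
{ split.
  - intros L [f [Cf ->]]; simpl.
    rewrite <- (busemann_geodesic z sg r Hz Hs Hr), Ew.
    apply path_length_busemann; [exact Cf | now apply norm2_geodesic_end].
  - intros b Hb; apply Hb; eexists; split; [exact Pf | now symmetry]. }
unfold hyp_dist; now rewrite (is_glb_Rbar_unique _ _ G).
Qed.

Lemma artanh_le r s : 0 <= r < 1 -> 0 <= s < 1 ->
  ln ((1 + r) / (1 - r)) <= ln ((1 + s) / (1 - s)) <-> r <= s.
Proof.
assert (M : forall r s, 0 <= r < 1 -> 0 <= s < 1 -> r < s ->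
  ln ((1 + r) / (1 - r)) < ln ((1 + s) / (1 - s))).
{ clear; intros r s Hr Hs H; apply ln_increasing; [apply Rdiv_lt_0_compat; lra |].
  apply Rminus_lt_0.
  replace ((1 + s) / (1 - s) - (1 + r) / (1 - r))
    with (2 * (s - r) / ((1 - s) * (1 - r))) by (field; lra).
  apply Rdiv_lt_0_compat; [lra | apply Rmult_lt_0_compat; lra]. }
intros Hr Hs; split; intro H.
- apply Rnot_lt_le; intro L; pose proof (M s r Hs Hr L); lra.
- destruct H as [H | ->]; [now apply Rlt_le, M | lra].
Qed.

Lemma hyp_dist_le z w : disk z -> disk w ->
  hyp_dist z (RtoC 0) <= hyp_dist z w <-> 1 - norm2 w <= norm2 (1 - Cconj w * z)%C.
Proof.
intros Hz Hw; rewrite !hyp_dist_formula by auto using disk_0.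
pose proof (disk_to_origin z _ Hz disk_0) as D0; pose proof (disk_to_origin z w Hz Hw) as Dw.
rewrite artanh_le by (split; [apply Cmod_ge_0 | assumption]).
pose proof (to_origin_norm2 z _ Hz disk_0) as E0; pose proof (to_origin_norm2 z w Hz Hw) as Ew.
pose proof (one_minus_neq0 z w Hz Hw) as N; apply norm2_pos in N.
replace (norm2 (1 - Cconj w * z)%C) with (norm2 (1 - Cconj z * w)%C)
  by (destruct z, w; unfold norm2; simpl; ring).
replace (norm2 (1 - Cconj z * RtoC 0)%C) with 1 in E0
  by (destruct z; unfold norm2, RtoC; simpl; ring).
replace (norm2 (RtoC 0)) with 0 in E0 by (unfold norm2, RtoC; simpl; ring).
pose proof (Cmod_ge_0 (to_origin z (RtoC 0))); pose proof (Cmod_ge_0 (to_origin z w)).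
apply disk_norm2 in Hz.
replace ((1 - norm2 z) * (1 - 0) / 1) with (1 - norm2 z) in E0 by field.
set (n := norm2 (1 - Cconj z * w)%C) in *.
assert (Q : (1 - norm2 z) * (1 - norm2 w) / n * n = (1 - norm2 z) * (1 - norm2 w))
  by (field; lra).
assert (L : Cmod (to_origin z (RtoC 0)) <= Cmod (to_origin z w) <->
  norm2 (to_origin z (RtoC 0)) <= norm2 (to_origin z w)).
{ rewrite <- !norm2_Cmod; split; intro; nra. }
rewrite L; split; intro H1.
- apply Rmult_le_reg_l with (1 - norm2 z); [lra |].
  rewrite <- Q, <- Ew; apply Rmult_le_compat_r; lra.
- assert (H2 : (1 - norm2 z) * (1 - norm2 w) <= (1 - norm2 z) * n)
    by (apply Rmult_le_compat_l; lra).
  rewrite <- Q, <- Ew in H2; apply Rmult_le_reg_r in H2; lra.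
Qed.

(** * The polygon and the Dirichlet domain *)

Lemma point_disk_form z a : disk a ->
  1 - norm2 a <= norm2 (1 - Cconj a * z)%C <-> form (lift z) base <= form (lift z) (point a).
Proof.
intro Ha; apply disk_norm2 in Ha; pose proof mu_sq as M.
unfold point; rewrite form_scale_r, form_lift, <- lift_0, form_lift.
replace (norm2 (1 - Cconj (RtoC 0) * z)%C) with 1
  by (destruct z; unfold norm2, RtoC; simpl; ring).
replace (norm2 (RtoC 0)) with 0 by (unfold norm2, RtoC; simpl; ring).
set (n := norm2 (1 - Cconj a * z)%C); set (k := 1 - norm2 a) in *.
assert (Hk : 0 < k) by (unfold k; lra).
assert (E : / k * ((4 - mu ^ 2) * (2 * n - (1 - norm2 z) * k))
  - (4 - mu ^ 2) * (2 * 1 - (1 - norm2 z) * (1 - 0)) = (2 * (4 - mu ^ 2) / k) * (n - k))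
  by (field; lra).
assert (P : 0 < 2 * (4 - mu ^ 2) / k) by (apply Rdiv_lt_0_compat; lra).
split; intro H.
- assert (0 <= (2 * (4 - mu ^ 2) / k) * (n - k)) by (apply Rmult_le_pos; lra); lra.
- assert (0 <= (2 * (4 - mu ^ 2) / k) * (n - k)) by lra.
  apply Rmult_le_reg_l with (2 * (4 - mu ^ 2) / k); lra.
Qed.

Section Action.

Variables r0 y0 : R.
Hypotheses (hr : is_r0 r0) (hy : is_y0 y0).

Lemma act_delta_nil g z : disk z -> delta_eq g [] -> act r0 y0 g z = z.
Proof.
intros Hz E; apply point_inj; auto using disk_act.
now rewrite point_act, (wact_delta _ _ E).
Qed.

Lemma act_app u v z : act r0 y0 (u ++ v) z = act r0 y0 u (act r0 y0 v z).
Proof. induction u; simpl; congruence. Qed.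

Lemma point_orbit g : point (act r0 y0 g (RtoC 0)) = wact g base.
Proof. rewrite point_act by auto using disk_0; now rewrite point_0. Qed.

(** Solving p a + conj q = 0 gives a = g^-1 0, and then q z + conj p = conj p (1 - conj a z): the
    isometric circle is the bisector of 0 and a. *)
Lemma represents_inverse_orbit p q g :
  represents r0 y0 p q g ->
  let a := act r0 y0 (rev g) (RtoC 0) in
  a = (- Cconj q / p)%C /\ norm2 p * (1 - norm2 a) = 1 /\
  forall z, norm2 p * norm2 (1 - Cconj a * z)%C = norm2 (q * z + Cconj p)%C.
Proof.
intros [Hpq R] a.
assert (N : norm2 p - norm2 q = 1) by (unfold in_SU11 in Hpq; now rewrite !norm2_Cmod in Hpq).
assert (Q0 : 0 <= norm2 q) by (unfold norm2; nra).
assert (P0 : p <> RtoC 0) by (apply norm2_pos; lra).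
assert (P0' : Cconj p <> RtoC 0) by (apply norm2_pos; rewrite norm2_conj; lra).
set (b := (- Cconj q / p)%C).
assert (Nb : norm2 b = norm2 q / norm2 p).
{ unfold b; rewrite norm2_div by exact P0; f_equal.
  destruct q; unfold norm2; simpl; ring. }
assert (Nb' : norm2 p * (1 - norm2 b) = 1) by (rewrite Nb; replace (norm2 q) with (norm2 p - 1) by lra; field; lra).
assert (Hb : disk b).
{ apply disk_norm2; apply Rnot_le_lt; intro L; nra. }
assert (Ga : act r0 y0 g b = RtoC 0).
{ rewrite R by exact Hb; unfold mobius.
  replace (p * b + Cconj q)%C with (RtoC 0) by (unfold b; field; exact P0).
  unfold Cdiv; ring. }
assert (Ea : a = b).
{ unfold a; rewrite <- Ga, <- act_app; apply act_delta_nil; [exact Hb | apply delta_rev_l]. }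
rewrite Ea; split; [reflexivity | split; [exact Nb' |]].
intro z; rewrite <- (norm2_conj p), <- norm2_mult; f_equal.
unfold b; rewrite Cdiv_conj by exact P0; rewrite Copp_conj, Cconj_conj; field; exact P0'.
Qed.

Lemma ext_I_closer g z :
  ext_I r0 y0 g z ->
  1 - norm2 (act r0 y0 (rev g) (RtoC 0)) <=
  norm2 (1 - Cconj (act r0 y0 (rev g) (RtoC 0)) * z)%C.
Proof.
intros [p [q [R [_ [_ H]]]]].
destruct (represents_inverse_orbit p q g R) as [_ [E1 E2]].
apply Rmult_le_reg_l with (norm2 p).
- destruct R as [Hpq _]; unfold in_SU11 in Hpq; rewrite !norm2_Cmod in Hpq.
  assert (0 <= norm2 q) by (unfold norm2; nra); lra.
- rewrite E1, E2, <- norm2_Cmod; nra.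
Qed.

Lemma closure_norm A z k : (forall w, A w -> Cmod w <= k) -> closure_C A z -> Cmod z <= k.
Proof.
intros H Hz; apply Rnot_lt_le; intro L.
destruct (Hz (Cmod z - k) ltac:(lra)) as [w [Hw D]].
pose proof (H w Hw); pose proof (Cmod_triangle w (- (w - z))%C) as T.
replace (w + - (w - z))%C with z in T by ring; rewrite Cmod_opp in T; lra.
Qed.

Lemma closure_affine A z c k : Cmod c <= 1 ->
  (forall w, A w -> k <= Cmod (1 - c * w)%C) -> closure_C A z -> k <= Cmod (1 - c * z)%C.
Proof.
intros Hc H Hz; apply Rnot_lt_le; intro L.
destruct (Hz (k - Cmod (1 - c * z)%C) ltac:(lra)) as [w [Hw D]].
pose proof (H w Hw); pose proof (Cmod_triangle (1 - c * z)%C (- (c * (w - z)))%C) as T.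
replace (1 - c * z + - (c * (w - z)))%C with (1 - c * w)%C in T by ring.
rewrite Cmod_opp, Cmod_mult in T.
pose proof (Cmod_ge_0 (w - z)%C).
assert (Cmod c * Cmod (w - z)%C <= 1 * Cmod (w - z)%C) by (apply Rmult_le_compat_r; lra).
lra.
Qed.

Lemma polygon_in_sides z : polygon_F r0 y0 z -> in_sides (lift z).
Proof.
intros Hz i Hi; unfold neighbour; rewrite <- point_orbit.
set (a := act r0 y0 (rev (gamma i)) (RtoC 0)).
assert (Ha : disk a) by (apply disk_act; auto using disk_0).
apply point_disk_form; [exact Ha |].
assert (Na : 0 <= 1 - norm2 a) by (apply disk_norm2 in Ha; lra).
assert (K : sqrt (1 - norm2 a) <= Cmod (1 - Cconj a * z)%C).
{ refine (closure_affine _ z _ _ _ _ Hz); [rewrite Cmod_conj; unfold disk in Ha; lra |].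
  intros w Hw; pose proof (ext_I_closer _ _ (Hw i Hi)) as P; fold a in P.
  rewrite <- (norm2_Cmod (1 - _)) in P; rewrite <- (sqrt_pow2 (Cmod _)) by apply Cmod_ge_0.
  now apply sqrt_le_1_alt. }
rewrite <- (norm2_Cmod (1 - _)), <- (pow2_sqrt (1 - norm2 a)) by exact Na.
apply pow_incr; split; [apply sqrt_pos | exact K].
Qed.

(** A point of the closure on the unit circle would lift to a nonzero null vector satisfying all
    side inequalities. *)
Lemma polygon_disk z : polygon_F r0 y0 z -> disk z.
Proof.
intro Hz; destruct (in_sides_dirichlet _ (polygon_in_sides z Hz)) as [_ N].
assert (L : Cmod z <= 1).
{ refine (closure_norm _ z _ _ Hz); intros w Hw.
  destruct (Hw 1%nat ltac:(lia)) as [p [q [_ [_ [D _]]]]]; unfold disk in D; lra. }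
destruct L as [L | L]; [exact L | exfalso].
assert (N1 : norm2 z = 1) by (rewrite <- norm2_Cmod, L; ring).
assert (F0 : form (lift z) (lift z) = 0).
{ rewrite form_lift.
  replace (norm2 (1 - Cconj z * z)%C) with ((1 - norm2 z) ^ 2)
    by (destruct z; unfold norm2; simpl; ring).
  rewrite N1; ring. }
pose proof (N ltac:(lra)) as Z; unfold lift in Z; injection Z as Z1 Z2 Z3.
pose proof sn_pos; pose proof dl_pos.
assert (X : Re z = 0).
{ apply Rmult_eq_reg_l with (2 * sn * 2 / dl); [| apply Rgt_not_eq, Rdiv_lt_0_compat; lra].
  rewrite Rmult_0_r, <- Z2; field; lra. }
assert (Y : Im z = 0).
{ apply Rmult_eq_reg_l with (2 * sn * (sn * 2) / dl);
    [| apply Rgt_not_eq, Rdiv_lt_0_compat; nra].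
  rewrite Rmult_0_r, <- Z1, X; field; lra. }
unfold norm2 in N1; rewrite X, Y in N1; lra.
Qed.

Lemma polygon_dirichlet z : polygon_F r0 y0 z -> dirichlet_domain r0 y0 (RtoC 0) z.
Proof.
intro Hz; pose proof (polygon_disk z Hz) as Dz; split; [exact Dz |].
destruct (in_sides_dirichlet _ (polygon_in_sides z Hz)) as [G _].
intros g Hg; assert (Da : disk (act r0 y0 g (RtoC 0))) by (apply disk_act; auto using disk_0).
apply hyp_dist_le; auto; apply point_disk_form; auto; rewrite point_orbit.
apply G, (Gamma_fixes_colours g Hg); simpl; tauto.
Qed.

Lemma gamma_even i : (1 <= i <= 42)%nat -> Nat.even (length (gamma i)) = true.
Proof.
assert (E : forallb (fun i => Nat.even (length (gamma i))) (seq 1 42) = true)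
  by (vm_compute; reflexivity).
rewrite forallb_forall in E; intro Hi; apply E, in_seq; lia.
Qed.

(** No gamma_i fixes 0, so each of them has an isometric circle. *)
Lemma neighbour_neq_base i : (1 <= i <= 42)%nat -> form base base < form base (neighbour i).
Proof.
assert (E : forallb (fun i => zpos (zsub (zform zbase (zneighbour i)) (zform zbase zbase)))
   (seq 1 42) = true) by (vm_compute; reflexivity).
rewrite forallb_forall in E; intro Hi; specialize (E i ltac:(apply in_seq; lia)).
apply zpos_spec in E; rewrite zval_sub, !zval_form, vval_zneighbour, vval_zbase in E; lra.
Qed.

(** Contraction towards 0 makes the inequality strict; in E the gain is the term with [norm2 q],
    positive since |z| < 1. *)
Lemma shrink_isometric p q z t :
  in_SU11 p q -> q <> RtoC 0 -> disk z -> 0 < t < 1 ->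
  1 <= norm2 (q * z + Cconj p)%C -> 1 < norm2 (q * (RtoC t * z) + Cconj p)%C.
Proof.
unfold in_SU11; rewrite !norm2_Cmod, norm2_pos, disk_norm2; intros Hpq Hq Hz Ht H.
assert (E : norm2 (q * (RtoC t * z) + Cconj p)%C - 1 =
  t * (norm2 (q * z + Cconj p)%C - 1) + norm2 q * ((1 - t) * (1 - t * norm2 z))
  + (norm2 p - norm2 q - 1) * (1 - t)).
{ destruct p, q, z; unfold norm2, RtoC; simpl; ring. }
rewrite Hpq in E.
assert (0 <= t * (norm2 (q * z + Cconj p)%C - 1)) by (apply Rmult_le_pos; lra).
assert (0 < norm2 q * ((1 - t) * (1 - t * norm2 z))).
{ apply Rmult_lt_0_compat; [exact Hq | apply Rmult_lt_0_compat; [lra |]].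
  assert (0 <= norm2 z) by (unfold norm2; nra); nra. }
lra.
Qed.

Lemma dirichlet_polygon z : dirichlet_domain r0 y0 (RtoC 0) z -> polygon_F r0 y0 z.
Proof.
intros [Dz H] eps Heps.
set (t := 1 - Rmin (1 / 2) (eps / 2)).
assert (Ht : 0 < t < 1 /\ 1 - t < eps).
{ unfold t; pose proof (Rmin_l (1 / 2) (eps / 2)); pose proof (Rmin_r (1 / 2) (eps / 2)).
  assert (0 < Rmin (1 / 2) (eps / 2)) by (apply Rmin_glb_lt; lra); lra. }
exists (RtoC t * z)%C; split.
- intros i Hi; destruct (even_represents r0 y0 _ hr hy (gamma_even i Hi)) as [p [q R]].
  exists p, q; split; [exact R |].
  destruct (represents_inverse_orbit p q _ R) as [Ea [E1 E2]].
  set (a := act r0 y0 (rev (gamma i)) (RtoC 0)) in *.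
  assert (Da : disk a) by (apply disk_act; auto using disk_0).
  assert (Hq : q <> RtoC 0).
  { intros ->; pose proof (neighbour_neq_base i Hi) as L; unfold neighbour in L.
    rewrite <- point_orbit in L; fold a in L.
    replace a with (RtoC 0) in L; [rewrite point_0 in L; lra |].
    rewrite Ea, Cconj_R; unfold Cdiv; ring. }
  split; [exact Hq |]; split.
  + apply disk_norm2; rewrite norm2_real_mult; apply disk_norm2 in Dz.
    assert (0 <= norm2 z) by (unfold norm2; nra); nra.
  + assert (K : 1 <= norm2 (q * z + Cconj p)%C).
    { rewrite <- E2; apply Rle_trans with (norm2 p * (1 - norm2 a)); [lra |].
      apply Rmult_le_compat_l; [unfold norm2; nra |].
      apply hyp_dist_le; auto; apply H, Gamma_inv, Gamma_gen; exact Hi. }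
    pose proof (shrink_isometric p q z t (proj1 R) Hq Dz (proj1 Ht) K) as S.
    rewrite <- norm2_Cmod in S; pose proof (Cmod_ge_0 (q * (RtoC t * z) + Cconj p)%C); nra.
- replace (RtoC t * z - z)%C with (- (RtoC (1 - t) * z))%C by (rewrite RtoC_minus; ring).
  rewrite Cmod_opp, Cmod_mult, Cmod_R, Rabs_pos_eq by lra.
  unfold disk in Dz; pose proof (Cmod_ge_0 z); nra.
Qed.

End Action.

(** * The stabilizer of 0 *)

(** The height over [base] grows strictly at the rightmost s3 of the word and never decreases
    afterwards. *)
Lemma reduced_fixing_base w :
  reduced w -> wact w base = base -> forall x, In x w -> x = s1 \/ x = s2.
Proof.
intros Hr Hw.
assert (P : (forall x, In x w -> x = s1 \/ x = s2) \/ form base base < form base (wact w base)).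
{ clear Hw; induction w as [| s w IH]; [now left |].
  pose proof (reduced_ascending s w Hr) as A.
  assert (Nb : nonneg base) by (intros []; unfold base; simpl; lra).
  change (wact (s :: w) base) with (refl s (wact w base)).
  destruct (IH (reduced_cons _ _ Hr)) as [H | H].
  - rewrite (wact_rotation_base w H).
    destruct s; [left; intros x [<- | Hx]; auto .. | right].
    pose proof mu_sq; unfold base; simpl; nra.
  - right; eapply Rlt_le_trans; [exact H | now apply form_ascend]. }
rewrite Hw in P; destruct P as [P | P]; [exact P | lra].
Qed.

(** The dihedral group acts faithfully on colours: its reduced words alternate and have length at
    most 7, and each nonempty one is seen to move a colour. *)
Lemma rotation_word_trivial w :
  reduced w -> (forall x, In x w -> x = s1 \/ x = s2) ->
  (forall x, In x colours -> col w x = x) -> w = [].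
Proof.
intros Hr Hw Hc.
assert (F : fixes_all w = true).
{ apply forallb_forall; intros x Hx; rewrite (Hc x Hx).
  unfold col_eqb; now rewrite !Nat.eqb_refl. }
clear Hc; destruct w as [| s w]; [reflexivity | exfalso].
assert (K : forall t, s <> t -> (forall x, In x w -> x = s \/ x = t) ->
  (s = s1 \/ s = s2) -> (t = s1 \/ t = s2) -> False).
{ intros t Hst Hl Hs Ht; pose proof (reduced_two_letters s t w Hst Hl Hr) as E.
  rewrite E in F, Hr; apply reduced_alt in Hr; [| exact Hst].
  simpl length in *; revert F Hr; generalize (length w); intros n F Hn.
  destruct Hs as [-> | ->], Ht as [-> | ->]; try easy; simpl in Hn;
    do 7 (destruct n as [| n]; [discriminate F |]); lia. }
destruct (Hw s (or_introl eq_refl)) as [-> | ->].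
- apply (K s2); auto; [easy |]; intros x Hx; apply Hw; now right.
- apply (K s1); auto; [easy |]; intros x Hx; destruct (Hw x (or_intror Hx)); auto.
Qed.

Lemma stabilizer_base r0 y0 : is_r0 r0 -> is_y0 y0 -> trivial_stabilizer r0 y0 (RtoC 0).
Proof.
intros hr hy g Hg H z Hz.
assert (B : wact g base = base) by (rewrite <- (point_orbit r0 y0 hr hy), H; apply point_0).
destruct (exists_reduced g) as [w [E Hr]].
rewrite (wact_delta _ _ E) in B.
assert (W : w = []).
{ apply rotation_word_trivial; auto; [now apply reduced_fixing_base |].
  intros x Hx; rewrite <- (col_delta _ _ E x Hx); now apply Gamma_fixes_colours. }
subst w; now apply act_delta_nil.
Qed.

Theorem theorem3p8 (r0 y0 : R) (hr0 : is_r0 r0) (hy0 : is_y0 y0) :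
  trivial_stabilizer r0 y0 (RtoC 0) /\
  forall z : C, polygon_F r0 y0 z <-> dirichlet_domain r0 y0 (RtoC 0) z.
Proof.
split; [now apply stabilizer_base |].
intro z; split; [now apply polygon_dirichlet | now apply dirichlet_polygon].
Qed.
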